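(* Let $1\le r\le d$ be integers. Let $F:\mathbb{R}^d\to\mathbb{R}$ be differentiable, bounded below with $F_*:=\inf_xF(x)>-\infty$, and $L$-smooth for some $L>0$, i.e. $\|\nabla F(x)-\nabla F(y)\|\le L\|x-y\|$ for all $x,y\in\mathbb{R}^d$. Fix an integer $T\ge1$, let $\eta>0$, $u\in(0,1)$, $\bar\eta=\eta T^{-u}$, let $\{x_k\}_{k\ge0}$ be generated from $x_0\in\mathbb{R}^d$ by RS-NGD with stepsize $\bar\eta$, and put $\Delta_0:=F(x_0)-F_*$. Then for any $\delta\in(0,1)$, with probability at least $1-\delta$, $$\frac1T\sum_{k=0}^{T-1}\|\nabla F(x_k)\|\le\frac{2\Delta_0}{\eta\tau T^{1-u}}+\frac{\eta}{\tau T^u}\frac drL+\frac3{\tau^2}\left(\frac dr\frac{\sqrt{2\Delta_0L}}{T}+\frac{\eta}{T^u}\left(\frac dr\right)^{3/2}L\right)\log\frac1\delta.$$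
   Context: $\|\cdot\|$ is the Euclidean norm. Haar matrix: a random $d\times r$ matrix $P$ equal to $\sqrt{d/r}$ times the first $r$ columns of a Haar-distributed random orthogonal matrix in $O(d)$. Thus $UP$ has the same law as $P$ for every $U\in O(d)$, $\mathbb{E}[PP^\top]=I_d$, $P^\top P=\frac dr I_r$, and $\|P^\top x\|>0$ almost surely for each fixed $x\neq0$. RS-NGD (randomized subspace normalized gradient descent): $x_0$ is deterministic, $P_0,P_1,\dots\in\mathbb{R}^{d\times r}$ are i.i.d. Haar matrices, and $x_{k+1}=x_k-\bar\eta G_k$, where $G_k=\frac{P_kP_k^\top\nabla F(x_k)}{\|P_k^\top\nabla F(x_k)\|}$ if $P_k^\top\nabla F(x_k)\neq0$ and $G_k=0$ otherwise. The constant $\tau$ is $$\tau=\sqrt{\frac dr}\,\frac{\Gamma\left(\frac{r+1}{2}\right)\Gamma\left(\frac d2\right)}{\Gamma\left(\frac r2\right)\Gamma\left(\frac{d+1}{2}\right)}.$$ *)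

(* Defs.v *)
From HB Require Import structures.
From mathcomp Require Import all_boot all_order all_algebra.
From mathcomp Require Import finmap.
From mathcomp Require Import all_classical all_reals all_analysis.

Set Implicit Arguments.
Unset Strict Implicit.
Unset Printing Implicit Defensive.

Import Order.TTheory GRing.Theory Num.Theory.
Import numFieldNormedType.Exports.

Local Open Scope classical_set_scope.
Local Open Scope ring_scope.

(* The library norm `|x| on matrices is the sup norm, so the Euclidean norm is
   defined separately; the two induce the same topology and hence the same
   notion of differentiability. *)
Definition enorm {R : realType} {n : nat} (x : 'cV[R]_n) : R :=
  Num.sqrt (\sum_i x i 0 ^+ 2).

Definition grad {R : realType} {n : nat} (F : 'cV[R]_n -> R) (x : 'cV[R]_n) :
    'cV[R]_n :=
  \col_i 'D_(delta_mx i 0) F x.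

Definition smooth {R : realType} {n : nat} (L : R) (F : 'cV[R]_n -> R) : Prop :=
  forall x y, enorm (grad F x - grad F y) <= L * enorm (x - y).

(* Euler's integral; meaningful for s > 0. *)
Definition Gamma {R : realType} (s : R) : R :=
  (\int[lebesgue_measure]_(t in `]0, +oo[) (t `^ (s - 1) * expR (- t)))%R.

Definition tau {R : realType} (d r : nat) : R :=
  Num.sqrt (d%:R / r%:R) *
  ((Gamma (r.+1%:R / 2) * Gamma (d%:R / 2)) /
   (Gamma (r%:R / 2) * Gamma (d.+1%:R / 2))).

(* 'M[R]_(m, n) with its Borel sigma-algebra. *)
Definition borelMx (R : realType) (m n : nat) : measurableType _ :=
  g_sigma_algebraType (@open 'M[R]_(m, n)).

Definition orthogonal_group {R : realType} (d : nat) : set 'M[R]_d :=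
  [set U | U^T *m U = 1%:M].

(* The Haar probability measure of O(d), seen as a Borel measure on the space of
   all d x d matrices that is carried by O(d). *)
Definition is_haar_orthogonal {R : realType} {d : nat}
    (mu : probability (borelMx R d d) R) : Prop :=
  mu (@orthogonal_group R d) = 1%E /\
  forall U : 'M[R]_d, orthogonal_group U ->
    forall A : set (borelMx R d d), measurable A -> mu (mulmx U @^-1` A) = mu A.

Definition scaled_first_cols {R : realType} {d r : nat} (hrd : (r <= d)%N)
    (Q : 'M[R]_d) : 'M[R]_(d, r) :=
  Num.sqrt (d%:R / r%:R) *: colsub (widen_ord hrd) Q.

(* X has the law of scaled_first_cols Q for Q a Haar-distributed element of
   O(d). Only the law of X is constrained: Q need not be defined on the same
   probability space as X. *)
Definition is_haar_matrix {R : realType} {d r : nat} (hrd : (r <= d)%N)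
    {disp : measure_display} {Omega : measurableType disp}
    (Pr : probability Omega R) (X : {RV Pr >-> borelMx R d r}) : Prop :=
  exists mu : probability (borelMx R d d) R, is_haar_orthogonal mu /\
    forall A : set (borelMx R d r), measurable A ->
      distribution Pr X A = mu (scaled_first_cols hrd @^-1` A).

Definition mutually_independent {R : realType}
    {disp disp' : measure_display} {Omega : measurableType disp}
    {E : measurableType disp'} (Pr : probability Omega R)
    (X : nat -> {RV Pr >-> E}) : Prop :=
  forall (J : {fset nat}) (A : nat -> set E), (forall k, measurable (A k)) ->
    Pr (\bigcap_(k in [set` J]) (X k @^-1` A k)) =
    (\prod_(k <- J) Pr (X k @^-1` A k))%E.

(* The law of a Haar matrix is unique (uniqueness of the Haar probability
   measure), so the X k are automatically identically distributed. *)
Definition iid_haar_matrices {R : realType} {d r : nat} (hrd : (r <= d)%N)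
    {disp : measure_display} {Omega : measurableType disp}
    (Pr : probability Omega R) (X : nat -> {RV Pr >-> borelMx R d r}) : Prop :=
  mutually_independent X /\ forall k, is_haar_matrix hrd (X k).

Definition ngd_direction {R : realType} {d r : nat}
    (P : 'M[R]_(d, r)) (g : 'cV[R]_d) : 'cV[R]_d :=
  if P^T *m g == 0 then 0 else (enorm (P^T *m g))^-1 *: (P *m P^T *m g).

Fixpoint rs_ngd {R : realType} {d r : nat} (F : 'cV[R]_d -> R) (step : R)
    (x0 : 'cV[R]_d) (P : nat -> 'M[R]_(d, r)) (k : nat) : 'cV[R]_d :=
  if k is k'.+1 then
    let x := rs_ngd F step x0 P k' in x - step *: ngd_direction (P k') (grad F x)
  else x0.

(* Main.v *)
Require Import Defs.
From HB Require Import structures.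
From mathcomp Require Import all_boot all_order all_algebra.
From mathcomp Require Import finmap ring lra.
From mathcomp Require Import all_classical all_reals all_analysis.
From mathcomp Require Import measurable_realfun.

Set Implicit Arguments.
Unset Strict Implicit.
Unset Printing Implicit Defensive.

Import Order.TTheory GRing.Theory Num.Theory.
Import numFieldNormedType.Exports.

Local Open Scope classical_set_scope.
Local Open Scope ring_scope.

(** Write g_k = grad F (x_k), q = d / r and s for the stepsize.  By the descent
lemma, one step decreases F by at least s |P_k^T g_k| - L s^2 q / 2, so almost
surely s * sum_k |P_k^T g_k| <= Delta0 + T L s^2 q / 2, and it remains to compare
|P^T g| with tau |g|.  Let y = |P^T g| / |g|.  Left-invariance of the law of P
alone gives E y^2 = 1 and E y^4 = (d + 2 q) / (d + 2).  A lower bound of y by a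
polynomial in y^2, together with exp (- z) <= 1 - z + z^2 / 2, then yields
E exp (- a y) <= exp (- a tau / 2) for 0 <= a <= 2 tau / (3 q).  The identity
tau = E y is not needed: tau^2 <= (d + 1) / d suffices for r < d, and it follows
from Gamma (z + 1) = z Gamma z and Gamma (z + 1/2) <= sqrt z * Gamma z.
Independence of the P_k turns the conditional estimate into
E exp (lam * sum_k (tau / 2 |g_k| - |P_k^T g_k|)) <= 1, and Markov's inequality
concludes. *)

(** * The Gamma function at half-integers *)

Section GammaFunction.
Context {R : realType}.
Notation mu := (@lebesgue_measure R).
Implicit Types (s t : R) (n : nat).

(** The stated bound dictates the parameters. Almost surely |g_k| <= M for k < T, where M = sqrt (2
    Delta0 L) + T L s sqrt q, and lam = 2 tau / (3 q M) is the value for which the Markov term log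
    (1 / delta) / lam, multiplied by 2 / (tau T), becomes the last summand of the bound. With a =
    lam |g_k| this is the origin of the range a <= 2 tau / (3 q). On that range the quadratic term
    a^2 / 2 costs at most a tau / (3 q), so aiming at tau / 2 leaves the requirement tau / 2 + tau /
    (3 q) <= (E y^4)^(-1/2). The right-hand side is the lower bound on E y that Hoelder's inequality
    gives when E y^2 = 1, from E y^2 <= (E y)^(2/3) (E y^4)^(1/3); a tangent polynomial yields the
    same value, so that only polynomial moments have to be computed. *)

Definition gamma_integrand s t : R := t `^ (s - 1) * expR (- t).

Lemma gamma_integrand_ge0 s t : 0 <= gamma_integrand s t.
Proof. by rewrite mulr_ge0 ?powR_ge0 ?expR_ge0. Qed.

Lemma measurable_gamma_integrand s (D : set R) :
  measurable_fun D (gamma_integrand s).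
Proof.
apply: (@measurable_funS _ _ _ _ setT) => //.
apply: measurable_funM; first exact: measurable_powR.
by apply: measurableT_comp => //; apply: measurableT_comp.
Qed.

Lemma measurable_gamma_integrandE s (D : set R) :
  measurable_fun D (fun t => (gamma_integrand s t)%:E).
Proof. by apply/measurable_EFinP; exact: measurable_gamma_integrand. Qed.

(** In [\bar R] the integral can be handled before it is known to be finite, so the functional
    equation and the half-step inequality can serve to prove finiteness. [Gamma] is its [fine],
    which would turn an infinite value into 0. *)
Definition egamma s := (\int[mu]_(t in `]0%R, +oo[) (gamma_integrand s t)%:E)%E.

Lemma GammaE s : Gamma s = fine (egamma s).
Proof. by []. Qed.

Lemma egamma_ge0 s : (0 <= egamma s)%E.
Proof. by apply: integral_ge0 => t _; rewrite lee_fin gamma_integrand_ge0. Qed.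

(** On these compact subintervals of the open half-line the integrand is continuous even for s < 1.
    The right end n + 2 keeps the interval nondegenerate at n = 0. *)
Definition gamma_window n : set R := `[n.+1%:R^-1, n.+2%:R].

Lemma gamma_window_gt0 n t : gamma_window n t -> 0 < t.
Proof. by rewrite /gamma_window /= in_itv /= => /andP[+ _]; apply: lt_le_trans. Qed.

Lemma nondecreasing_gamma_window : nondecreasing_seq gamma_window.
Proof.
move=> n m nm; rewrite subsetEset => t.
rewrite /gamma_window /= !in_itv /= => /andP[a b]; apply/andP; split.
  by apply: le_trans a; rewrite lef_pV2 ?posrE// ler_nat ltnS.
by apply: (le_trans b); rewrite ler_nat !ltnS.
Qed.

Lemma bigcup_gamma_window : \bigcup_n gamma_window n = [set` `]0%R, +oo[].
Proof.
apply/seteqP; split=> [t [n _ /gamma_window_gt0 t0]|t].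
  by rewrite /= in_itv /= t0.
rewrite /= in_itv /= andbT => t0.
pose n := maxn (Num.truncn t^-1) (Num.truncn t).
exists n => //; rewrite /gamma_window /= in_itv /=; apply/andP; split.
  rewrite invf_ple ?posrE//.
  apply: (@le_trans _ _ (Num.truncn t^-1).+1%:R); first exact/ltW/truncnS_gt.
  by rewrite ler_nat ltnS leq_maxl.
apply: (@le_trans _ _ (Num.truncn t).+1%:R); first exact/ltW/truncnS_gt.
by rewrite ler_nat ltnS leqW// leq_maxr.
Qed.

Lemma cvg_egamma s :
  (\int[mu]_(t in gamma_window n) (gamma_integrand s t)%:E)%E @[n --> \oo]
  --> egamma s.
Proof.
rewrite /egamma -bigcup_gamma_window; apply: ge0_nondecreasing_set_cvg_integral.
- exact: nondecreasing_gamma_window.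
- by move=> n; exact: measurable_itv.
- by move=> n; exact: measurable_gamma_integrandE.
- by move=> n t _; rewrite lee_fin gamma_integrand_ge0.
Qed.

Lemma is_derive_gamma_primitive s t : 0 < t ->
  is_derive t 1 (fun x : R => x `^ s * expR (- x))
    (s * gamma_integrand s t - gamma_integrand (s + 1) t).
Proof.
move=> t0.
have -> : s * gamma_integrand s t - gamma_integrand (s + 1) t =
  t `^ s *: (expR (- t) * -1) + expR (- t) *: (s * t `^ (s - 1)).
  by rewrite /gamma_integrand addrK /GRing.scale /=; ring.
have dE : is_derive t 1 (fun x : R => expR (- x)) (expR (- t) * -1).
  exact: is_derive1_comp.
have := @is_derive1_powR R s t t0.
by move=> dP; apply: is_deriveM.
Qed.

Lemma continuous_gamma_integrand s t : 0 < t ->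
  {for t, continuous (gamma_integrand s)}.
Proof.
move=> t0; have := @is_derive_gamma_primitive (s - 1) t t0.
by move=> [/derivable1_diffP/differentiable_continuous].
Qed.

End GammaFunction.

(** * Functional equation, half-step inequality, and bounds on tau *)

Section GammaRatios.
Context {R : realType}.
Notation mu := (@lebesgue_measure R).
Implicit Types (s t : R) (n : nat).

Lemma integrable_gamma_window s n :
  mu.-integrable (gamma_window n) (fun t => (gamma_integrand s t)%:E).
Proof.
apply: continuous_compact_integrable; first exact: segment_compact.
apply: continuous_in_subspaceT => t; rewrite inE => /gamma_window_gt0 t0.
exact: continuous_gamma_integrand.
Qed.

(** The fundamental theorem of calculus for x^s exp (- x), whose derivative is the difference of the
    two integrands. *)
Lemma gamma_window_by_parts s n :
  (s%:E * (\int[mu]_(t in gamma_window n) (gamma_integrand s t)%:E) =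
   \int[mu]_(t in gamma_window n) (gamma_integrand (s + 1) t)%:E +
   (n.+2%:R `^ s * expR (- n.+2%:R) -
    n.+1%:R^-1 `^ s * expR (- n.+1%:R^-1))%:E)%E.
Proof.
have ab : n.+1%:R^-1 < n.+2%:R :> R.
  apply: (@le_lt_trans _ _ 1); last by rewrite ltr1n.
  by rewrite invf_le1 ?ler1n.
have W0 t : t \in `[n.+1%:R^-1, n.+2%:R] -> 0 < t by exact: gamma_window_gt0.
have cF t : t \in `[n.+1%:R^-1, n.+2%:R] ->
    {for t, continuous (fun x : R => x `^ s * expR (- x))}.
  move=> /W0 t0; have [] := @is_derive_gamma_primitive R s t t0.
  by move=> /derivable1_diffP/differentiable_continuous.
have cf t : 0 < t -> {for t, continuous
    (fun t => s * gamma_integrand s t - gamma_integrand (s + 1) t)}.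
  move=> t0; apply: cvgB; last exact: continuous_gamma_integrand.
  by apply: cvgM; [exact: cvg_cst|exact: continuous_gamma_integrand].
have := @continuous_FTC2 R
  (fun t => s * gamma_integrand s t - gamma_integrand (s + 1) t)
  (fun x => x `^ s * expR (- x)) _ _ ab.
rewrite EFinB => <-.
- rewrite -/(gamma_window n).
  under [X in _ = (_ + X)%E]eq_integral do rewrite EFinB EFinM.
  rewrite integralB//=; last 3 first.
  + by apply: measurable_itv.
  + by apply: integrableZl; [exact: measurable_itv|exact: integrable_gamma_window].
  + exact: integrable_gamma_window.
  rewrite integralZl//; [|exact: measurable_itv|exact: integrable_gamma_window].
  rewrite addeC subeK// integrable_fin_num//; first exact: measurable_itv.
  exact: integrable_gamma_window.
- apply: continuous_in_subspaceT => t; rewrite inE => /W0; exact: cf.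
- split.
  + move=> t /subset_itv_oo_cc /W0 t0.
    by have [] := @is_derive_gamma_primitive R s t t0.
  + by apply/cvg_at_right_filter/cF; rewrite in_itv /= lexx ltW.
  + by apply/cvg_at_left_filter/cF; rewrite in_itv /= lexx ltW.
- move=> t /subset_itv_oo_cc /W0 t0.
  by rewrite derive1E; have [] := @is_derive_gamma_primitive R s t t0.
Qed.

Lemma cvg_gamma_boundary s : 0 < s ->
  (n.+2%:R `^ s * expR (- n.+2%:R) - n.+1%:R^-1 `^ s * expR (- n.+1%:R^-1) : R)
  @[n --> \oo] --> (0 : R).
Proof.
move=> s0; rewrite -[X in _ --> X](subrr 0); apply: cvgB.
  (* Since m > s, t^s <= t^m for t >= 1, and the single term t^(m+1) / (m+1)! of the exponential
     series leaves the bound (m+1)! / t. *)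
  pose m := (Num.truncn s).+1.
  have sm t : 1 <= t -> t `^ s <= t ^+ m.
    move=> t1; rewrite -powR_mulrn ?(le_trans ler01)//.
    by apply: ler_powR => //; exact/ltW/truncnS_gt.
  apply: (@squeeze_cvgr _ _ _ _ (fun=> 0)
     (fun n => m.+1`!%:R * n.+2%:R^-1)).
  - near=> n; rewrite mulr_ge0 ?powR_ge0 ?expR_ge0//=.
    have n2 : (0 : R) < n.+2%:R by rewrite ltr0n.
    apply: (@le_trans _ _ (n.+2%:R ^+ m * expR (- n.+2%:R))).
      by rewrite ler_wpM2r ?expR_ge0// sm// ler1n.
    rewrite expRN ler_pdivrMr ?expR_gt0// mulrAC ler_pdivlMr//.
    rewrite -exprSr -ler_pdivrMl ?ltr0n ?fact_gt0// mulrC.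
    apply: (le_trans _ (expR_ge1Dxn m _)); last exact: ltW.
    by rewrite lerDr.
  - exact: cvg_cst.
  - rewrite -[X in _ --> X](mulr0 m.+1`!%:R); apply: cvgM; first exact: cvg_cst.
    have := @cvg_harmonic R; rewrite -(cvg_shiftn 1).
    by under eq_fun do rewrite addn1.
apply: (@squeeze_cvgr _ _ _ _ (fun=> 0) (fun n => n.+1%:R^-1 `^ s)).
- near=> n; rewrite mulr_ge0 ?powR_ge0 ?expR_ge0//=.
  by rewrite ler_piMr ?powR_ge0// -expR0 ler_expR oppr_le0 invr_ge0.
- exact: cvg_cst.
have /cvg_at_rightP/(_ (fun n => n.+1%:R^-1)) := powR_cvg0 s0.
by apply; split; [move=> n; rewrite invr_gt0|exact: cvg_harmonic].
Unshelve. all: by end_near. Qed.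

Lemma egammaS s : 0 < s -> egamma (s + 1) = (s%:E * egamma s)%E.
Proof.
move=> s0.
have c1 := cvgeZl (isT : s%:E \is a fin_num) (@cvg_egamma R s).
have c2 : ((\int[mu]_(t in gamma_window n) (gamma_integrand (s + 1) t)%:E +
   (n.+2%:R `^ s * expR (- n.+2%:R) -
    n.+1%:R^-1 `^ s * expR (- n.+1%:R^-1))%:E)%E @[n --> \oo] -->
   (egamma (s + 1)%R + 0%:E)%E).
  apply: cvgeD; [by rewrite fin_num_adde_defl|exact: cvg_egamma|].
  by apply: cvg_EFin; [near=> n|exact: cvg_gamma_boundary].
rewrite adde0 in c2.
apply: cvg_unique c2 _ => //.
apply: cvg_trans c1; apply: near_eq_cvg; near=> n.
exact: gamma_window_by_parts.
Unshelve. all: by end_near. Qed.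

Lemma egamma1 : egamma (1 : R) = 1%E.
Proof.
rewrite /egamma integral_itv_obnd_cbnd; last first.
  exact: measurable_gamma_integrandE.
rewrite (@ge0_continuous_FTC2y R _ (fun t => - expR (- t)) 0 0) /=.
- by rewrite oppr0 expR0 opprK -EFinD add0r.
- by move=> t _; exact: gamma_integrand_ge0.
- have -> : gamma_integrand 1 = (fun t : R => expR (- t)).
    by apply/funext => t; rewrite /gamma_integrand subrr powRr0 mul1r.
  apply: continuous_subspaceT => t.
  by apply: continuous_comp; [exact: opp_continuous|exact: continuous_expR].
- by rewrite -oppr0; apply: cvgN; exact: cvgr_expR.
- move=> t _; have [] // : is_derive t 1
    (fun x : R => - expR (- x)) (- (expR (- t) * -1)).
  by apply: is_deriveN; exact: is_derive1_comp.
- apply: cvgN; apply: cvg_at_right_filter.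
  by apply: continuous_comp; [exact: opp_continuous|exact: continuous_expR].
- move=> t _; rewrite derive1E /gamma_integrand subrr powRr0 mul1r.
  have [_ ->] : is_derive t 1 (fun x : R => - expR (- x)) (- (expR (- t) * -1)).
    by apply: is_deriveN; exact: is_derive1_comp.
  by rewrite mulrN1 opprK.
Qed.

(** Pointwise, sqrt t <= sqrt s / 2 + t / (2 sqrt s) by the inequality of arithmetic and geometric
    means, with equality at t = s. Integrating against the integrand at s and using [egammaS] on the
    second term makes both terms equal to half of the right-hand side. *)
Lemma egamma_half_step s : 0 < s ->
  (egamma (s + 2^-1) <= (Num.sqrt s)%:E * egamma s)%E.
Proof.
move=> s0; have r0 : 0 < Num.sqrt s by rewrite sqrtr_gt0.
have r2 : Num.sqrt s * Num.sqrt s = s by rewrite -expr2 sqr_sqrtr// ltW.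
have -> : ((Num.sqrt s)%:E * egamma s =
   (Num.sqrt s / 2)%:E * egamma s + (2 * Num.sqrt s)^-1%:E * egamma (s + 1)%R)%E.
  rewrite egammaS// muleA -EFinM -ge0_muleDl ?lee_fin; first last.
  - by rewrite mulr_ge0 ?invr_ge0 ?mulr_ge0// ltW.
  - by rewrite divr_ge0// ltW.
  congr (_%:E * _)%E; rewrite -{4}r2; field; exact: lt0r_neq0.
rewrite /egamma -!ge0_integralZl_EFin//=; first last.
all: try by move=> *; rewrite lee_fin gamma_integrand_ge0.
all: try exact: measurable_gamma_integrandE.
all: try by rewrite ?invr_ge0 ?mulr_ge0// ltW.
rewrite -ge0_integralD//=; first last.
all: try by move=> *; rewrite -EFinM lee_fin
  mulr_ge0 ?gamma_integrand_ge0// ?invr_ge0 ?mulr_ge0// ltW.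
all: try by (apply: measurable_funeM; exact: measurable_gamma_integrandE).
apply: ge0_le_integral => //=.
- by move=> *; rewrite lee_fin gamma_integrand_ge0.
- exact: measurable_gamma_integrandE.
- by apply: emeasurable_funD; apply: measurable_funeM; exact: measurable_gamma_integrandE.
move=> t; rewrite in_itv /= andbT => t0; rewrite -!EFinM -EFinD lee_fin.
rewrite /gamma_integrand !mulrA -mulrDl ler_wpM2r ?expR_ge0//.
have t0' : t != 0 by rewrite gt_eqF.
have -> : t `^ (s + 2^-1 - 1) = t `^ (s - 1) * Num.sqrt t.
  by rewrite -powR12_sqrt ?ltW// -powRD ?t0' ?implybT//; congr (_ `^ _); ring.
have -> : t `^ (s + 1 - 1) = t `^ (s - 1) * (Num.sqrt t) ^+ 2.
  by rewrite sqr_sqrtr ?ltW// mulrC mulr_powRB1// ?addrK// ltW.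
rewrite [X in _ <= _ + X]mulrCA [X in _ <= X + _]mulrC -mulrDr ler_wpM2l ?powR_ge0//.
rewrite -subr_ge0.
have -> : Num.sqrt s / 2 + (2 * Num.sqrt s)^-1 * Num.sqrt t ^+ 2 - Num.sqrt t
  = (2 * Num.sqrt s)^-1 * (Num.sqrt t - Num.sqrt s) ^+ 2.
  by field; rewrite lt0r_neq0.
by rewrite mulr_ge0 ?sqr_ge0// invr_ge0 mulr_ge0// ltW.
Qed.


Lemma egamma_natS n : egamma (n.+1%:R : R) = (n`!%:R)%:E.
Proof.
elim: n => [|n ih]; first by rewrite egamma1 fact0.
by rewrite -[n.+2%:R]natr1 egammaS// ih -EFinM factS natrM.
Qed.


(** At even n the value is a factorial. At odd n the half step bounds the positive value at n + 1 by
    a multiple of the value at n, so positivity descends. *)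
Lemma egamma_half_gt0 n : (0 < n)%N -> (0 < egamma (n%:R / 2 : R))%E.
Proof.
have even_gt0 m : (0 < egamma (m.+1.*2%:R / 2 : R))%E.
  by rewrite -muln2 natrM mulfK// egamma_natS lte_fin ltr0n fact_gt0.
move=> n0; have [on|on] := boolP (odd n); last first.
  case: n n0 on => [//|[//|n]] _ /=; rewrite negbK => on.
  by rewrite -(odd_double_half n) (negbTE on) add0n -doubleS.
have s0 : 0 < (n%:R / 2 : R) by rewrite divr_gt0// ltr0n.
have : (0 < egamma (n%:R / 2 + 2^-1 : R))%E.
  have -> : n%:R / 2 + 2^-1 = n.+1%:R / 2 :> R by rewrite -(natr1 n) mulrDl mul1r.
  by rewrite -(odd_double_half n) on add1n -doubleS.
move=> /lt_le_trans /(_ (egamma_half_step s0)).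
by rewrite pmule_rgt0// lte_fin sqrtr_gt0.
Qed.

(** Finiteness ascends along the half step, from even n to n + 1. This does not reach n = 1, which
    is obtained from n = 3 by the functional equation. *)
Lemma egamma_half_fin n : (0 < n)%N -> (egamma (n%:R / 2 : R) < +oo)%E.
Proof.
have even_fin m : (egamma (m.+1.*2%:R / 2 : R) < +oo)%E.
  by rewrite -muln2 natrM mulfK// egamma_natS ltry.
have step (m : nat) : (0 < m)%N -> (egamma (m%:R / 2 : R) < +oo)%E ->
    (egamma (m.+1%:R / 2 : R) < +oo)%E.
  move=> m0 fm; have s0 : 0 < (m%:R / 2 : R) by rewrite divr_gt0// ltr0n.
  rewrite -natr1 mulrDl mul1r; apply: le_lt_trans (egamma_half_step s0) _.
  by apply: lte_mul_pinfty => //; rewrite lee_fin sqrtr_ge0.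
case: n => [//|[_|n _]].
  have := step 2%N isT (even_fin 0%N).
  have -> : 3%:R / 2 = 2^-1 + 1 :> R by field.
  rewrite egammaS ?invr_gt0// mul1r.
  case: (egamma 2^-1) => [x|//|]; rewrite ?ltry//.
  by rewrite gt0_muley// lte_fin invr_gt0.
have [on|on] := boolP (odd n); last first.
  by rewrite -[n](odd_double_half n) (negbTE on) add0n -doubleS.
by apply: step => //; rewrite -[n](odd_double_half n) on add1n -doubleS.
Qed.

Lemma Gamma_half_gt0 n : (0 < n)%N -> 0 < Gamma (n%:R / 2 : R).
Proof. by move=> n0; apply: fine_gt0; rewrite egamma_half_gt0// egamma_half_fin. Qed.

Lemma egamma_halfE n : (0 < n)%N -> egamma (n%:R / 2 : R) = (Gamma (n%:R / 2))%:E.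
Proof.
move=> n0; rewrite GammaE fineK// ge0_fin_numE ?egamma_ge0//.
exact: egamma_half_fin.
Qed.

Lemma Gamma_half_step n : (0 < n)%N ->
  Gamma (n.+1%:R / 2 : R) ^+ 2 <= n%:R / 2 * Gamma (n%:R / 2) ^+ 2.
Proof.
move=> n0; have s0 : 0 < (n%:R / 2 : R) by rewrite divr_gt0// ltr0n.
have : Gamma (n.+1%:R / 2 : R) <= Num.sqrt (n%:R / 2) * Gamma (n%:R / 2).
  rewrite -lee_fin EFinM -!egamma_halfE// -natr1 mulrDl mul1r.
  exact: egamma_half_step.
have -> : n%:R / 2 * Gamma (n%:R / 2) ^+ 2 =
  (Num.sqrt (n%:R / 2) * Gamma (n%:R / 2 : R)) ^+ 2.
  by rewrite exprMn sqr_sqrtr// ltW.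
have g0 m : (0 < m)%N -> 0 <= Gamma (m%:R / 2 : R) by move=> *; rewrite ltW// Gamma_half_gt0.
by move=> h; rewrite lerXn2r// nnegrE ?mulr_ge0 ?sqrtr_ge0// g0.
Qed.

Lemma Gamma_halfSS n : (0 < n)%N ->
  Gamma (n.+2%:R / 2 : R) = n%:R / 2 * Gamma (n%:R / 2).
Proof.
move=> n0; have s0 : 0 < (n%:R / 2 : R) by rewrite divr_gt0// ltr0n.
apply: EFin_inj; rewrite EFinM -(egamma_halfE n0) -(egammaS s0).
by rewrite -egamma_halfE//; congr egamma; rewrite -addn2 natrD mulrDl divff.
Qed.

Lemma tau_gt0 (d r : nat) : (0 < r)%N -> (0 < d)%N -> 0 < tau d r :> R.
Proof.
move=> r0 d0; rewrite /tau mulr_gt0 ?sqrtr_gt0 ?divr_gt0 ?ltr0n//.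
by rewrite !mulr_gt0 ?invr_gt0 ?mulr_gt0// Gamma_half_gt0.
by rewrite mulr_gt0// Gamma_half_gt0.
Qed.

Lemma tau_diag (d : nat) : (0 < d)%N -> tau d d = 1 :> R.
Proof.
move=> d0; rewrite /tau divff ?pnatr_eq0 -?lt0n// sqrtr1 mul1r.
rewrite [Gamma (d%:R / 2) * _]mulrC divff// mulf_neq0// gt_eqF// Gamma_half_gt0//.
Qed.

(** Product of two half steps: the one at r / 2 bounds the ratio in r from above, and the one at (d
    + 1) / 2, combined with Gamma (d / 2 + 1) = d / 2 * Gamma (d / 2), bounds the ratio in d. The
    prefactor d / r cancels the dependence on r. *)
Lemma tau_sqr_le (d r : nat) : (0 < r)%N -> (0 < d)%N ->
  tau d r ^+ 2 <= d.+1%:R / d%:R :> R.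
Proof.
move=> r0 d0; rewrite /tau !exprMn sqr_sqrtr ?divr_ge0//.
have dp : (0 : R) < d%:R by rewrite ltr0n.
have rp : (0 : R) < r%:R by rewrite ltr0n.
have a0 := Gamma_half_gt0 r0; have b0 := Gamma_half_gt0 (ltn0Sn r).
have c0 := Gamma_half_gt0 d0; have e0 := Gamma_half_gt0 (ltn0Sn d).
have h1 := Gamma_half_step r0; have h2 := Gamma_half_step (ltn0Sn d).
rewrite Gamma_halfSS// in h2.
move: a0 b0 c0 e0 h1 h2.
move: (Gamma (r%:R / 2)) (Gamma (r.+1%:R / 2)) (Gamma (d%:R / 2))
  (Gamma (d.+1%:R / 2)) => a b c e a0 b0 c0 e0 h1 h2.
rewrite exprVn exprMn mulrA ler_pdivrMr ?exprn_gt0 ?mulr_gt0//.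
have := ler_pM _ _ h1 h2; rewrite !sqr_ge0 => /(_ isT isT) h.
have k0 : 0 < 4 / (d%:R * r%:R) :> R by rewrite divr_gt0// mulr_gt0.
have -> : d%:R / r%:R * (b ^+ 2 * c ^+ 2) =
  4 / (d%:R * r%:R) * (b ^+ 2 * (d%:R / 2 * c) ^+ 2).
  by field; rewrite !gt_eqF.
have -> : d.+1%:R / d%:R * (a ^+ 2 * e ^+ 2) =
  4 / (d%:R * r%:R) * (r%:R / 2 * a ^+ 2 * (d.+1%:R / 2 * e ^+ 2)).
  by field; rewrite !gt_eqF.
by rewrite ler_pM2l.
Qed.

(* An equality at d = 2, r = 1; the case r = d needs the exact value of tau. *)
Lemma tau_moment_bound (d r : nat) : (0 < r)%N -> (r <= d)%N ->
  let q : R := d%:R / r%:R in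
  (tau d r * (2^-1 + (3 * q)^-1)) ^+ 2 * (d%:R + 2 * q) <= d%:R + 2.
Proof.
move=> r0 rd /=; set q : R := d%:R / r%:R; have d0 := leq_trans r0 rd.
have dp : (0 : R) < d%:R by rewrite ltr0n.
have rp : (0 : R) < r%:R by rewrite ltr0n.
move: rd; rewrite leq_eqVlt => /predU1P[rdE|rd].
  rewrite /q rdE tau_diag// divff ?gt_eqF// !mul1r !mulr1.
  have -> : (2^-1 + 3^-1) ^+ 2 = 25 / 36 :> R by field.
  by rewrite ler_piMl ?addr_ge0 ?ltW// ltr_pdivrMr// mul1r ltr_nat.
have ht := tau_sqr_le r0 d0; rewrite (exprMn _ (tau d r)).
apply: (@le_trans _ _ (d.+1%:R / d%:R * (2^-1 + (3 * q)^-1) ^+ 2 * (d%:R + 2 * q))).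
  rewrite ler_wpM2r ?addr_ge0 ?mulr_ge0 ?invr_ge0//.
  by rewrite ler_wpM2r// sqr_ge0.
(* The claim with denominators cleared. Substituting r = j + 1 and d = j + 2 + k, which encodes r <
   d, turns the difference of the two sides into a polynomial in j and k with nonnegative
   coefficients and no constant term. *)
have key : (d.+1 * (3 * d + 2 * r) ^ 2 * (r + 2))%N%:R <=
    (36 * d ^ 2 * r * (d + 2))%N%:R :> R.
  rewrite ler_nat; case: r r0 rd {q ht rp} => [//|j] _ rd.
  rewrite -(subnKC rd); move: (d - j.+2)%N => k.
  have -> : (36 * (j.+2 + k) ^ 2 * j.+1 * (j.+2 + k + 2) =
    (j.+2 + k).+1 * (3 * (j.+2 + k) + 2 * j.+1) ^ 2 * (j.+1 + 2) +
    (192 * j + 96 * k + 239 * j ^ 2 + 434 * j * k + 94 * j ^ 3 +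
     301 * j ^ 2 * k + 63 * k ^ 2 + 204 * j * k ^ 2 + 11 * j ^ 4 +
     53 * j ^ 3 * k + 69 * j ^ 2 * k ^ 2 + 9 * k ^ 3 + 27 * j * k ^ 3))%N.
    by ring.
  exact: leq_addr.
have -> : d.+1%:R / d%:R * (2^-1 + (3 * q)^-1) ^+ 2 * (d%:R + 2 * q) =
  ((d.+1) * (3 * d + 2 * r) ^ 2 * (r + 2))%N%:R / (36 * d%:R ^+ 2 * r%:R).
  rewrite !(natrM, natrD) -(natr1 d) /q; field.
  by rewrite !gt_eqF.
rewrite ler_pdivrMr ?mulr_gt0 ?exprn_gt0//; apply: le_trans key _.
by rewrite le_eqVlt; apply/orP; left; apply/eqP; rewrite !(natrM, natrD); ring.
Qed.

End GammaRatios.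

(** * Borel sets of matrices *)

Section BorelMatrices.
Context {R : realType} {m n : nat}.
Implicit Types (M : 'M[R]_(m, n)).

Lemma measurable_continuous_borelMx (g : 'M[R]_(m, n) -> R) :
  continuous g -> measurable_fun setT (g : borelMx R m n -> R).
Proof.
move=> cg; apply: (measurability (@RGenOpens.G R)).
  exact: RGenOpens.measurableE.
move=> _ [_ [x [y ->]] <-]; apply: sub_sigma_algebra; rewrite setTI.
apply: open_comp => [M _|]; first exact: cg.
exact: interval_open.
Qed.

Lemma measurable_borelMx_coord i j :
  measurable_fun setT (fun M : borelMx R m n => (M : 'M[R]_(m, n)) i j).
Proof. by apply: measurable_continuous_borelMx; exact: coord_continuous. Qed.

(** There are countably many of these boxes and they form a base of the topology, which reduces
    measurability of a map into [borelMx] to that of its entries. *)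
Definition rat_box (p : 'M[rat]_(m, n) * rat) : set 'M[R]_(m, n) :=
  [set M | forall i j, `|ratr (p.1 i j) - M i j| < ratr p.2].

Lemma open_bigcup_rat_box (U : set 'M[R]_(m, n)) : open U ->
  U = \bigcup_(p in [set p | rat_box p `<=` U]) rat_box p.
Proof.
move=> oU; apply/seteqP; split=> [M UM|M [p pU] /pU//].
have /nbhs_ballP[e /= e0 eU] : nbhs M U by exact: open_nbhs_nbhs.
have [e' ] : exists e' : rat, ratr e' \in `]0, e / 2[.
  by apply: rat_in_itvoo; rewrite divr_gt0.
rewrite in_itv /= => /andP[e'0 e'e].
have /choice[q qP] (ij : 'I_m * 'I_n) : exists q : rat,
    ratr q \in `]M ij.1 ij.2 - ratr e', M ij.1 ij.2 + ratr e'[.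
  by apply: rat_in_itvoo; rewrite ltrD2l gtrN.
have qM i j : `|ratr (q (i, j)) - M i j| < ratr e'.
  by have := qP (i, j); rewrite in_itv /= -ltr_distlC distrC.
exists (\matrix_(i, j) q (i, j), e'); last by move=> i j /=; rewrite mxE.
move=> N NP; apply: eU; split=> // i j; rewrite /ball /=.
have := NP i j; rewrite /= mxE => NPij.
rewrite -[M i j](subrK (ratr (q (i, j)))) -addrA; apply: le_lt_trans (ler_normD _ _) _.
rewrite (splitr e) ltrD//; last exact: lt_trans NPij _.
by rewrite distrC; exact: lt_trans (qM i j) _.
Qed.

Lemma measurable_fun_borelMx d (T : measurableType d)
    (f : T -> borelMx R m n) :
  (forall i j, measurable_fun setT (fun t => (f t : 'M[R]_(m, n)) i j)) ->
  measurable_fun setT f.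
Proof.
move=> mf; apply: (@measurability _ _ T (borelMx R m n) setT f
  (@open 'M[R]_(m, n))) => // _ [U oU <-].
rewrite setTI (open_bigcup_rat_box oU) preimage_bigcup bigcup_mkcond.
apply: countable_bigcupT_measurable => // p; case: ifPn => // _.
have -> : f @^-1` rat_box p = \bigcap_(ij in [set: 'I_m * 'I_n])
    [set t | `|ratr (p.1 ij.1 ij.2) - (f t : 'M[R]_(m, n)) ij.1 ij.2| < ratr p.2].
  apply/seteqP; split=> [t tp [i j] _ /=|t tp i j]; first exact: tp.
  exact: (tp (i, j)).
apply: fin_bigcap_measurable => [|[i j] _]; first exact: finite_finset.
have mh : measurable_fun setT
    (fun t => `|ratr (p.1 i j) - (f t : 'M[R]_(m, n)) i j|).
  by apply: measurableT_comp => //; apply: measurable_funB => //; exact: mf.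
have := mh measurableT _ (measurable_itv `]-oo, (ratr p.2 : R)[).
rewrite setTI; congr measurable.
Qed.

End BorelMatrices.

(** * Independence *)

Section Independence.
Context {R : realType} {disp : measure_display} {Omega : measurableType disp}
  {Pr : probability Omega R}.
Local Open Scope ereal_scope.

Definition image_measure {d d' : measure_display} {T1 : measurableType d}
    {T2 : measurableType d'} (mu : {measure set T1 -> \bar R}) {h : T1 -> T2}
    (mh : measurable_fun setT h) : {measure set T2 -> \bar R} :=
  measure_function_pushforward__canonical__measure_function_Measure mu mh.

(** As functions of D, both sides are finite measures; agreeing on a generating pi-system, they
    coincide. *)
Lemma independent_event_generator {d : measure_display} {E : measurableType d}
    (G : set (set E)) (h : Omega -> E) (C : set Omega) :
  d.-measurable = <<s G >> -> setI_closed G -> G setT ->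
  measurable_fun setT h -> measurable C ->
  (forall D, G D -> Pr (h @^-1` D `&` C) = Pr (h @^-1` D) * Pr C) ->
  forall D, measurable D -> Pr (h @^-1` D `&` C) = Pr (h @^-1` D) * Pr C.
Proof.
move=> GE GI GT mh mC indep D mD.
have [c c0 pCE] : exists2 c : R, (0 <= c)%R & Pr C = c%:E.
  by exists (fine (Pr C)); rewrite ?fine_ge0// fineK// fin_num_measure.
pose m1 : measure E R := image_measure (mrestr Pr mC) mh.
pose m2 : measure E R := mscale (NngNum c0) (image_measure Pr mh).
have m12 := @measure_unique _ R E G (fun=> setT) GE GI (fun=> GT) _ m1 m2.
have -> : Pr (h @^-1` D `&` C) = m1 D by [].
rewrite m12//.
- by rewrite muleC pCE.
- by rewrite bigcup_const.
- by move=> A GA; rewrite /m1 /= /pushforward /mrestr indep// muleC pCE.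
- by move=> _; rewrite /m1 /= /pushforward /mrestr preimage_setT setTI pCE ltry.
Qed.

Lemma independent_pair_event {d1 d2 : measure_display}
    {E1 : measurableType d1} {E2 : measurableType d2}
    (V : Omega -> E1) (X : Omega -> E2) (C : set Omega) :
  measurable_fun setT V -> measurable_fun setT X -> measurable C ->
  (forall A B, measurable A -> measurable B ->
    Pr (V @^-1` A `&` X @^-1` B `&` C) = Pr (V @^-1` A `&` X @^-1` B) * Pr C) ->
  forall D, measurable D ->
    Pr ((fun w => (V w, X w)) @^-1` D `&` C) =
    Pr ((fun w => (V w, X w)) @^-1` D) * Pr C.
Proof.
move=> mV mX mC indep D mD.
pose rectangles : set (set (E1 * E2)) :=
  [set A `*` B | A in measurable & B in measurable].
apply: (independent_event_generator (G := rectangles)) => //.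
- exact: measurable_prod_measurableType.
- move=> _ _ [A1 mA1 [B1 mB1 <-]] [A2 mA2 [B2 mB2 <-]].
  by rewrite -setXI; exists (A1 `&` A2); [exact: measurableI|];
    exists (B1 `&` B2); [exact: measurableI|].
- by exists setT => //; exists setT => //; rewrite setXTT.
- exact: measurable_fun_pair.
- by move=> _ [A mA [B mB <-]]; exact: indep.
Qed.

(** A conditional expectation bound phrased without conditional expectations: by independence the
    joint law of V and X is the product law, and Tonelli's theorem integrates X out first for a
    fixed value of V. *)
Lemma independent_integral_le {d1 d2 : measure_display}
    {E1 : measurableType d1} {E2 : measurableType d2}
    (V : {RV Pr >-> E1}) (X : {RV Pr >-> E2})
    (f : E1 * E2 -> \bar R) (g : E1 -> \bar R) :
  (forall A B, measurable A -> measurable B ->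
    Pr (V @^-1` A `&` X @^-1` B) = Pr (V @^-1` A) * Pr (X @^-1` B)) ->
  measurable_fun setT f -> (forall z, 0 <= f z) ->
  measurable_fun setT g -> (forall v, 0 <= g v) ->
  (forall v, \int[distribution Pr X]_p f (v, p) <= g v) ->
  \int[Pr]_w f (V w, X w) <= \int[Pr]_w g (V w).
Proof.
move=> indep mf f0 mg g0 fg.
have mVX : measurable_fun setT (fun w => (V w, X w)).
  exact: measurable_fun_pair.
pose m : measure (E1 * E2)%type R := image_measure Pr mVX.
have mE D : measurable D -> (distribution Pr V \x distribution Pr X) D = m D.
  move=> mD; apply: (@product_measure_unique _ _ _ _ _ _ _ m) => //.
have -> : \int[Pr]_w f (V w, X w) =
    \int[(distribution Pr V \x distribution Pr X)]_z f z.
  rewrite (@eq_measure_integral _ _ _ _ m); last by move=> D mD _; exact: mE.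
  by rewrite ge0_integral_pushforward.
rewrite fubini_tonelli1//.
rewrite -(ge0_integral_distribution V)//; apply: ge0_le_integral => //.
- by move=> v _; exact: integral_ge0.
- exact: measurable_fun_fubini_tonelli_F.
- by move=> v _; exact: fg.
Qed.

Lemma independent_recursion {d1 d2 : measure_display}
    {E1 : measurableType d1} {E2 : measurableType d2}
    (X : nat -> {RV Pr >-> E2}) (phi : E1 * E2 -> E1) (v0 : E1)
    (V : nat -> Omega -> E1) :
  mutually_independent X -> measurable_fun setT phi ->
  (forall w, V 0%N w = v0) ->
  (forall k w, V k.+1 w = phi (V k w, X k w)) ->
  (forall k, measurable_fun setT (V k)) /\
  (forall k A B, measurable A -> measurable B ->
    Pr (V k @^-1` A `&` X k @^-1` B) = Pr (V k @^-1` A) * Pr (X k @^-1` B)).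
Proof.
move=> indX mphi V0 VS.
have mV k : measurable_fun setT (V k).
  elim: k => [|k ih].
    by rewrite (_ : V 0%N = cst v0); [exact: measurable_cst|exact/funext].
  rewrite (_ : V k.+1 = phi \o (fun w => (V k w, X k w))); last first.
    by apply/funext => w; exact: VS.
  by apply: measurableT_comp => //; exact: measurable_fun_pair.
split=> // k A B mA mB.
have mX (D : nat -> set E2) (J : {fset nat}) : (forall j, measurable (D j)) ->
    measurable (\bigcap_(j in [set` J]) (X j @^-1` D j)).
  move=> mD; apply: fin_bigcap_measurable => // j _.
  by rewrite -[X in measurable X]setTI; exact: measurable_funPT.
(* The induction needs all finite families of the X_j with j >= k, not X_k alone: at step k + 1 the
   state is a function of the previous state and X_k, so the hypothesis at k must separate the state
   from X_k jointly with the later X_j. *)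
suff key (J : {fset nat}) (D : nat -> set E2) (A' : set E1) :
    (forall j, j \in J -> (k <= j)%N) -> (forall j, measurable (D j)) ->
    measurable A' ->
    Pr (V k @^-1` A' `&` \bigcap_(j in [set` J]) (X j @^-1` D j)) =
    Pr (V k @^-1` A') * \prod_(j <- J) Pr (X j @^-1` D j).
  have := key [fset k]%fset (fun=> B) A.
  rewrite set_fset1 bigcap_set1 big_seq_fset1; apply=> //.
  by move=> j; rewrite inE => /eqP ->.
elim: k J D A' {A B mA mB} => [|k ih] J D A' kJ mD mA'.
  rewrite (_ : V 0%N = cst v0); last exact/funext.
  rewrite preimage_cst; case: ifPn => _.
    by rewrite setTI indX// probability_setT mul1e.
  by rewrite set0I measure0 mul0e.
rewrite (_ : V k.+1 @^-1` A' =
    (fun w => (V k w, X k w)) @^-1` (phi @^-1` A')); last first.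
  by apply/seteqP; split=> w /=; rewrite VS.
rewrite -indX//; apply: independent_pair_event => //.
- exact: mX.
- move=> A B mA mB.
  have kJ' : k \notin J by apply/negP => /kJ; rewrite ltnn.
  (* Merging the event on X_k with those on the later X_j allows the induction hypothesis to be
     applied to the family indexed by k and J. *)
  pose D' j := if j == k then B else D j.
  have mD' j : measurable (D' j) by rewrite /D'; case: ifP.
  have D'J : \bigcap_(j in [set` J]) (X j @^-1` D' j) =
             \bigcap_(j in [set` J]) (X j @^-1` D j).
    apply: eq_bigcapr => j /= jJ; rewrite /D'; case: eqP => // jk.
    by move: kJ'; rewrite -jk jJ.
  have := ih (k |` J)%fset D' A _ mD' mA.
  rewrite bigcap_fsetU1 D'J big_fsetU1//= /D' eqxx.
  have -> : \prod_(i <- J) Pr (X i @^-1` (if i == k then B else D i)) =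
    \prod_(i <- J) Pr (X i @^-1` (D i)).
    apply: eq_big_seq => j jJ; case: eqP => // jk.
    by move: kJ'; rewrite -jk jJ.
  rewrite setIA muleA indX// => ->.
    have := ih [fset k]%fset (fun=> B) A.
    rewrite set_fset1 bigcap_set1 big_seq_fset1 => -> //.
    by move=> j; rewrite inE => /eqP ->.
  by move=> j /fset1UP[->//|/kJ/ltnW].
- rewrite -[X in measurable X]setTI; exact: mphi.
Qed.

End Independence.

(** * Euclidean geometry *)

Section EuclideanNorm.
Context {R : realType}.

Definition dotv {n : nat} (x y : 'cV[R]_n) : R := \sum_i x i 0 * y i 0.

Lemma mulmx_trE {n : nat} (x y : 'cV[R]_n) : x^T *m y = (dotv x y)%:M.
Proof.
apply/matrixP => i j; rewrite !ord1 !mxE eqxx mulr1n.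
by apply: eq_bigr => k _; rewrite mxE.
Qed.

Lemma dotvE {n : nat} (x y : 'cV[R]_n) : dotv x y = (x^T *m y) 0 0.
Proof. by rewrite mulmx_trE mxE mulr1n. Qed.

Lemma dotvC {n : nat} (x y : 'cV[R]_n) : dotv x y = dotv y x.
Proof. by apply: eq_bigr => i _; rewrite mulrC. Qed.

Lemma dotvDl {n : nat} (x y z : 'cV[R]_n) : dotv (x + y) z = dotv x z + dotv y z.
Proof. by rewrite -big_split; apply: eq_bigr => i _; rewrite mxE mulrDl. Qed.

Lemma dotvZl {n : nat} a (x z : 'cV[R]_n) : dotv (a *: x) z = a * dotv x z.
Proof. by rewrite mulr_sumr; apply: eq_bigr => i _; rewrite mxE mulrA. Qed.

Lemma dotvDr {n : nat} (x y z : 'cV[R]_n) : dotv z (x + y) = dotv z x + dotv z y.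
Proof. by rewrite dotvC dotvDl !(dotvC z). Qed.

Lemma dotvZr {n : nat} a (x z : 'cV[R]_n) : dotv z (a *: x) = a * dotv z x.
Proof. by rewrite dotvC dotvZl dotvC. Qed.

Lemma dotvNl {n : nat} (x z : 'cV[R]_n) : dotv (- x) z = - dotv x z.
Proof. by rewrite -scaleN1r dotvZl mulN1r. Qed.

Lemma dotvNr {n : nat} (x z : 'cV[R]_n) : dotv z (- x) = - dotv z x.
Proof. by rewrite dotvC dotvNl dotvC. Qed.

Lemma dotv_ge0 {n : nat} (x : 'cV[R]_n) : 0 <= dotv x x.
Proof. by apply: sumr_ge0 => i _; rewrite -expr2 sqr_ge0. Qed.

Lemma enorm_ge0 {n : nat} (x : 'cV[R]_n) : 0 <= enorm x.
Proof. exact: sqrtr_ge0. Qed.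

Lemma sqr_enorm {n : nat} (x : 'cV[R]_n) : enorm x ^+ 2 = dotv x x.
Proof.
rewrite /enorm sqr_sqrtr; first by apply: eq_bigr => i _; rewrite expr2.
by apply: sumr_ge0 => i _; rewrite sqr_ge0.
Qed.

Lemma enormE {n : nat} (x : 'cV[R]_n) : enorm x = Num.sqrt (dotv x x).
Proof. by rewrite -sqr_enorm sqrtr_sqr ger0_norm ?enorm_ge0. Qed.

Lemma dotv_eq0 {n : nat} (x : 'cV[R]_n) : (dotv x x == 0) = (x == 0).
Proof.
apply/idP/eqP => [|->]; last first.
  by rewrite /dotv big1// => i _; rewrite mxE mulr0.
rewrite psumr_eq0 => [/allP x0|i _]; last by rewrite -expr2 sqr_ge0.
apply/colP => i; have := x0 i (mem_index_enum i).
by rewrite mulf_eq0 orbb mxE => /eqP.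
Qed.

Lemma enorm_eq0 {n : nat} (x : 'cV[R]_n) : (enorm x == 0) = (x == 0).
Proof. by rewrite -dotv_eq0 -sqr_enorm sqrf_eq0. Qed.

Lemma enorm0 {n : nat} : enorm (0 : 'cV[R]_n) = 0.
Proof. by apply/eqP; rewrite enorm_eq0. Qed.

Lemma enormZ {n : nat} a (x : 'cV[R]_n) : enorm (a *: x) = `|a| * enorm x.
Proof.
by rewrite !enormE dotvZl dotvZr mulrA -expr2 sqrtrM ?sqr_ge0// sqrtr_sqr.
Qed.

Lemma enormN {n : nat} (x : 'cV[R]_n) : enorm (- x) = enorm x.
Proof. by rewrite -scaleN1r enormZ normrN1 mul1r. Qed.

(** Cauchy-Schwarz: the squared norm of |y| x - |x| y equals 2 |x| |y| (|x| |y| - <x, y>), and is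
    nonnegative. *)
Lemma dotv_le {n : nat} (x y : 'cV[R]_n) : dotv x y <= enorm x * enorm y.
Proof.
have [->|x0] := eqVneq x 0.
  by rewrite /dotv big1 ?enorm0 ?mul0r// => i _; rewrite mxE mul0r.
have [->|y0] := eqVneq y 0.
  by rewrite /dotv big1 ?enorm0 ?mulr0// => i _; rewrite mxE mulr0.
have nx : 0 < enorm x by rewrite lt_def enorm_eq0 x0 enorm_ge0.
have ny : 0 < enorm y by rewrite lt_def enorm_eq0 y0 enorm_ge0.
have := dotv_ge0 (enorm y *: x - enorm x *: y).
rewrite dotvDl !dotvDr !dotvNl !dotvNr !dotvZl !dotvZr -!sqr_enorm (dotvC y x).
move=> h; rewrite -subr_ge0.
rewrite -(pmulr_rge0 _ (mulr_gt0 (ltr0n _ 2) (mulr_gt0 nx ny))).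
by apply: le_trans h _; rewrite le_eqVlt; apply/orP; left; apply/eqP; ring.
Qed.

Lemma ler_enormD {n : nat} (x y : 'cV[R]_n) : enorm (x + y) <= enorm x + enorm y.
Proof.
rewrite -ler_sqr ?nnegrE ?addr_ge0 ?enorm_ge0//.
rewrite sqr_enorm dotvDl !dotvDr sqrrD !sqr_enorm (dotvC y x).
have := dotv_le x y; lra.
Qed.

(** The witness is the Householder reflection in the hyperplane orthogonal to z = x - y. It sends x
    to y because |x| = |y| gives <z, x> = |z|^2 / 2. *)
Lemma orthogonal_transitive {n : nat} (x y : 'cV[R]_n) : enorm x = enorm y ->
  exists2 U : 'M[R]_n, orthogonal_group U & U^T *m x = y.
Proof.
move=> xy; have [->|] := eqVneq x y.
  by exists 1%:M; rewrite /orthogonal_group /= ?trmx1 ?mul1mx.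
rewrite -subr_eq0 -dotv_eq0 => z0; set z := x - y in z0 *.
pose a := 2 / dotv z z.
pose U : 'M[R]_n := 1%:M - a *: (z *m z^T).
have UT : U^T = U.
  by rewrite /U linearB /= trmx1 linearZ /= trmx_mul trmxK.
exists U; rewrite /orthogonal_group /= UT.
  rewrite /U mulmxBl mulmxBr mul1mx mulmxBr mulmx1 mul1mx.
  rewrite -!scalemxAl -!scalemxAr !mulmxA -(mulmxA z) mulmx_trE.
  rewrite scalar_mxC -mulmxA mul_scalar_mx !scalerA.
  rewrite opprB -[RHS]addr0 -addrA; congr (_ + _).
  rewrite addrCA -opprD -scalerDl -scalerBl -[RHS](scale0r (z *m z^T)).
  by congr (_ *: _); rewrite /a; field.
rewrite /U mulmxBl mul1mx -scalemxAl -mulmxA mulmx_trE scalar_mxC mul_scalar_mx.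
rewrite scalerA.
have -> : a * dotv z x = 1.
  have -> : dotv z x = dotv z z / 2.
    rewrite /z !(dotvDl, dotvDr, dotvNl, dotvNr) -!sqr_enorm xy (dotvC y x).
    by field.
  by rewrite /a; field.
by rewrite scale1r /z opprB addrC subrK.
Qed.

Lemma enorm_delta {n : nat} (i : 'I_n) : enorm (delta_mx i 0 : 'cV[R]_n) = 1.
Proof.
rewrite enormE /dotv (bigD1 i)//= big1 => [|j ji]; last first.
  by rewrite !mxE (negbTE ji) mul0r.
by rewrite !mxE !eqxx mulr1 addr0 sqrtr1.
Qed.

Lemma dotv_delta {n : nat} (i j : 'I_n) :
  dotv (delta_mx i 0) (delta_mx j 0) = (i == j)%:R.
Proof.
rewrite /dotv (bigD1 i)//= big1 => [|k ki]; last first.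
  by rewrite !mxE (negbTE ki) mul0r.
by rewrite !mxE !eqxx mul1r addr0 andbT.
Qed.

End EuclideanNorm.

(** * Moments of a left-invariant law on scaled Stiefel matrices *)

Lemma expRN_le_quadratic {R : realType} (x : R) : 0 <= x ->
  expR (- x) <= 1 - x + x ^+ 2 / 2.
Proof.
move=> x0; rewrite -subr_ge0.
pose f (t : R) := 1 - t + t ^+ 2 / 2 - expR (- t).
have df (t : R) : is_derive t 1 f (- 1 + t + expR (- t)).
  apply: is_derive_eq.
  by rewrite !scaler0 /GRing.scale /=; field.
have f0 : f 0 = 0 by rewrite /f oppr0 expR0; ring.
rewrite -[X in X <= _]f0; apply: (@ger0_derive1_ndecr _ f 0 x) => //.
- move=> t _; rewrite derive1E; have [_ ->] := df t.
  by have := expR_ge1Dx (- t); lra.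
- apply: derivable_within_continuous => t _; by have [] := df t.
Qed.

Section HaarMoments.
Context {R : realType} {d r : nat} (r_gt0 : (0 < r)%N) (rd : (r <= d)%N).
Variable nu : probability (borelMx R d r) R.
Let q : R := d%:R / r%:R.

Definition scaled_stiefel : set (borelMx R d r) :=
  [set p : 'M[R]_(d, r) | p^T *m p = q%:M].
Local Notation D := scaled_stiefel.

Hypothesis nu_invariant : forall U : 'M[R]_d, orthogonal_group U ->
  forall A : set (borelMx R d r), measurable A -> nu (mulmx U @^-1` A) = nu A.
Hypothesis nu_stiefel : nu D = 1%E.

Let d_gt0 : (0 < d)%N. Proof. exact: leq_trans rd. Qed.

Lemma measurable_stiefel : measurable D.
Proof.
have -> : D = \bigcap_(ij in [set: 'I_r * 'I_r])
  ((fun p : borelMx R d r =>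
     \sum_k (p : 'M[R]_(d, r)) k ij.1 * (p : 'M[R]_(d, r)) k ij.2)
     @^-1` [set (q%:M : 'M[R]_r) ij.1 ij.2]).
  apply/seteqP; split=> [p pD [i j] _ /=|p pD].
    by rewrite -pD mxE; apply: eq_bigr => k _; rewrite mxE.
  apply/matrixP => i j; rewrite -[RHS](pD (i, j) I) mxE.
  by apply: eq_bigr => k _; rewrite mxE.
apply: fin_bigcap_measurable => [|[i j] _]; first exact: finite_finset.
rewrite -[X in measurable X]setTI.
apply: measurable_sum => // k; apply: measurable_funM; exact: measurable_borelMx_coord.
Qed.

(** Boundedness is asked only on the scaled Stiefel set, where every entry is at most sqrt q in
    absolute value. The class is closed under sums and products, hence contains all polynomials in
    the entries, and settles every integrability condition below. *)
Definition haar_bounded (f : 'M[R]_(d, r) -> R) : Prop :=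
  measurable_fun setT (f : borelMx R d r -> R) /\
  exists M, forall p, D p -> `|f p| <= M.

Lemma haar_bounded_integrable f : haar_bounded f ->
  nu.-integrable D (fun p : borelMx R d r => (f p)%:E).
Proof.
move=> [mf [M fM]]; apply: measurable_bounded_integrable.
- exact: measurable_stiefel.
- by apply: (@le_lt_trans _ _ 1%E); [exact: probability_le1 measurable_stiefel|exact: ltry].
- by apply: measurable_funTS.
- exists M; split; first exact: num_real.
  by move=> x Mx p pD /=; apply: le_trans (fM p pD) (ltW Mx).
Qed.

Lemma haar_bounded_cst c : haar_bounded (fun=> c).
Proof. by split; [exact: measurable_cst|exists `|c|]. Qed.

Lemma haar_boundedD f g : haar_bounded f -> haar_bounded g ->
  haar_bounded (fun p => f p + g p).
Proof.
move=> [mf [M fM]] [mg [N gN]]; split; first exact: measurable_funD.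
exists (M + N) => p pD; apply: le_trans (ler_normD _ _) _.
by rewrite lerD ?fM ?gN.
Qed.

Lemma haar_boundedM f g : haar_bounded f -> haar_bounded g ->
  haar_bounded (fun p => f p * g p).
Proof.
move=> [mf [M fM]] [mg [N gN]]; split; first exact: measurable_funM.
exists (M * N) => p pD; rewrite normrM; apply: ler_pM => //; [exact: fM|exact: gN].
Qed.

Lemma haar_boundedX f n : haar_bounded f -> haar_bounded (fun p => f p ^+ n).
Proof.
move=> bf; elim: n => [|n ih]; first by under eq_fun do rewrite expr0; exact: haar_bounded_cst.
by under eq_fun do rewrite exprS; exact: haar_boundedM.
Qed.

Lemma haar_bounded_sum (I : Type) (s : seq I) (f : I -> 'M[R]_(d, r) -> R) :
  (forall i, haar_bounded (f i)) -> haar_bounded (fun p => \sum_(i <- s) f i p).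
Proof.
move=> bf; elim: s => [|i s ih].
  by under eq_fun do rewrite big_nil; exact: haar_bounded_cst.
by under eq_fun do rewrite big_cons; exact: haar_boundedD.
Qed.

Lemma haar_bounded_coord i j : haar_bounded (fun p => p i j).
Proof.
split; first exact: measurable_borelMx_coord.
exists (Num.sqrt q) => p pD; rewrite -sqrtr_sqr ler_wsqrtr//.
have -> : q = \sum_k p k j ^+ 2.
  have := congr1 (fun M : 'M[R]_r => M j j) pD; rewrite !mxE eqxx mulr1n => <-.
  by apply: eq_bigr => k _; rewrite mxE expr2.
by rewrite (bigD1 i)//= lerDl sumr_ge0// => k _; rewrite sqr_ge0.
Qed.

Definition haar_mean (f : 'M[R]_(d, r) -> R) : R :=
  (\int[nu]_(p in D) f p)%R.

Lemma eq_haar_mean f g : (forall p, D p -> f p = g p) ->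
  haar_mean f = haar_mean g.
Proof. by move=> fg; apply: eq_Rintegral => p /set_mem; exact: fg. Qed.

Lemma haar_mean_cst c : haar_mean (fun=> c) = c.
Proof.
rewrite /haar_mean Rintegral_cst; last exact: measurable_stiefel.
by rewrite -[RHS]mulr1; congr (_ * _); exact: (congr1 fine nu_stiefel).
Qed.

Lemma haar_meanD f g : haar_bounded f -> haar_bounded g ->
  haar_mean (fun p => f p + g p) = haar_mean f + haar_mean g.
Proof.
by move=> bf bg; apply: RintegralD;
  [exact: measurable_stiefel|exact: haar_bounded_integrable..].
Qed.

Lemma haar_meanZ c f : haar_bounded f ->
  haar_mean (fun p => c * f p) = c * haar_mean f.
Proof.
by move=> bf; apply: RintegralZl;
  [exact: measurable_stiefel|exact: haar_bounded_integrable].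
Qed.

Lemma le_haar_mean f g : haar_bounded f -> haar_bounded g ->
  (forall p, D p -> f p <= g p) -> haar_mean f <= haar_mean g.
Proof.
move=> bf bg fg; rewrite /haar_mean; apply: le_Rintegral => //.
- exact: measurable_stiefel.
- exact: haar_bounded_integrable.
- exact: haar_bounded_integrable.
Qed.

Lemma haar_mean_sum (I : Type) (s : seq I) (f : I -> 'M[R]_(d, r) -> R) :
  (forall i, haar_bounded (f i)) ->
  haar_mean (fun p => \sum_(i <- s) f i p) = \sum_(i <- s) haar_mean (f i).
Proof.
move=> bf; elim: s => [|i s ih].
  by under eq_haar_mean do rewrite big_nil; rewrite big_nil haar_mean_cst.
under eq_haar_mean do rewrite big_cons.
by rewrite haar_meanD ?ih ?big_cons//; exact: haar_bounded_sum.
Qed.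

Lemma measurable_mulmx (U : 'M[R]_d) :
  measurable_fun setT (mulmx U : borelMx R d r -> borelMx R d r).
Proof.
apply: measurable_fun_borelMx => i j.
rewrite (_ : (fun p => _) =
  (fun p : borelMx R d r => \sum_k U i k * (p : 'M[R]_(d, r)) k j)); last first.
  by apply/funext => p; rewrite mxE.
by apply: measurable_sum => k; apply: measurable_funM => //; exact: measurable_borelMx_coord.
Qed.

Lemma stiefel_mulmx (U : 'M[R]_d) (p : 'M[R]_(d, r)) : orthogonal_group U ->
  D (U *m p) <-> D p.
Proof.
move=> oU; rewrite /scaled_stiefel /= trmx_mul mulmxA -(mulmxA p^T).
by rewrite (oU : U^T *m U = 1%:M) mulmx1.
Qed.

Lemma haar_mean_mulmx (U : 'M[R]_d) f : orthogonal_group U -> haar_bounded f ->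
  haar_mean (fun p => f (U *m p)) = haar_mean f.
Proof.
move=> oU bf; have [mf [M fM]] := bf.
have DU : mulmx U @^-1` D = D.
  by apply/seteqP; split=> p /= /(stiefel_mulmx p oU).
have mD := measurable_stiefel.
rewrite /haar_mean /Rintegral; congr fine.
have bfU : haar_bounded (fun p => f (U *m p)).
  split; first by apply: (measurableT_comp mf); exact: measurable_mulmx.
  by exists M => p pD; apply: fM; apply/stiefel_mulmx.
have mE : measurable_fun setT (fun p : borelMx R d r => (f p)%:E).
  exact/measurable_EFinP.
have := @integral_pushforward _ _ _ _ R _ (measurable_mulmx U) nu D _ mE.
rewrite DU => /(_ (haar_bounded_integrable bfU) mD) <-.
apply: eq_measure_integral; first exact: measurable_mulmx.
by move=> mU A mA _; exact: nu_invariant.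
Qed.

Lemma haar_bounded_sqr_enorm w :
  haar_bounded (fun p : 'M[R]_(d, r) => enorm (p^T *m w) ^+ 2).
Proof.
rewrite (_ : (fun p => _) = (fun p : 'M[R]_(d, r) =>
  \sum_j (\sum_i p i j * w i 0) ^+ 2)); last first.
  apply/funext => p; rewrite sqr_enorm; apply: eq_bigr => j _.
  by rewrite -expr2 mxE; congr (_ ^+ 2); apply: eq_bigr => i _; rewrite mxE.
apply: haar_bounded_sum => j; apply: haar_boundedX; apply: haar_bounded_sum => i.
by apply: haar_boundedM; [exact: haar_bounded_coord|exact: haar_bounded_cst].
Qed.

Lemma haar_moment_rotate k w w' : enorm w = enorm w' ->
  haar_mean (fun p => (enorm (p^T *m w) ^+ 2) ^+ k) =
  haar_mean (fun p => (enorm (p^T *m w') ^+ 2) ^+ k).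
Proof.
move=> /orthogonal_transitive[U oU <-].
rewrite -(haar_mean_mulmx oU) => [|]; last first.
  by apply: haar_boundedX; exact: haar_bounded_sqr_enorm.
by apply: eq_haar_mean => p _; rewrite trmx_mul mulmxA.
Qed.

Let e0 : 'cV[R]_d := delta_mx (Ordinal d_gt0) 0.

(** Orthogonal maps act transitively on spheres and the moment is homogeneous in w, so invariance
    leaves a single unknown constant for each k. *)
Lemma haar_moment_scale k w :
  haar_mean (fun p => (enorm (p^T *m w) ^+ 2) ^+ k) =
  (enorm w ^+ 2) ^+ k * haar_mean (fun p => (enorm (p^T *m e0) ^+ 2) ^+ k).
Proof.
rewrite (@haar_moment_rotate _ _ (enorm w *: e0)); last first.
  by rewrite enormZ enorm_delta mulr1 ger0_norm// enorm_ge0.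
rewrite -haar_meanZ; last by apply: haar_boundedX; exact: haar_bounded_sqr_enorm.
apply: eq_haar_mean => p _.
rewrite -scalemxAr enormZ ger0_norm ?enorm_ge0// -exprMn; congr (_ ^+ k).
by rewrite exprMn.
Qed.

Lemma sqr_enorm_tr (p : 'M[R]_(d, r)) w :
  enorm (p^T *m w) ^+ 2 = (w^T *m (p *m p^T) *m w) 0 0.
Proof.
by rewrite sqr_enorm dotvE trmx_mul trmxK !mulmxA.
Qed.

Lemma sqr_enorm_tr_delta (p : 'M[R]_(d, r)) i :
  enorm (p^T *m delta_mx i 0) ^+ 2 = (p *m p^T) i i.
Proof. by rewrite sqr_enorm_tr -mulmxA trmx_delta -colE -rowE !mxE. Qed.

Lemma gram_sym (p : 'M[R]_(d, r)) i l : (p *m p^T) i l = (p *m p^T) l i.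
Proof. by rewrite -[in LHS](trmxK p) -trmx_mul trmxK mxE. Qed.

Lemma sqr_enorm_tr_deltaD (p : 'M[R]_(d, r)) i l (s : R) : s ^+ 2 = 1 ->
  enorm (p^T *m (delta_mx i 0 + s *: delta_mx l 0)) ^+ 2 =
  (p *m p^T) i i + (p *m p^T) l l + 2 * s * (p *m p^T) i l.
Proof.
move=> s2; rewrite mulmxDr sqr_enorm dotvDl !dotvDr -!sqr_enorm.
rewrite -scalemxAr enormZ exprMn real_normK ?num_real// s2 mul1r !sqr_enorm_tr_delta.
rewrite dotvZl dotvZr (dotvC (p^T *m delta_mx l 0)).
have -> : dotv (p^T *m delta_mx i 0) (p^T *m delta_mx l 0) = (p *m p^T) i l.
  rewrite dotvE trmx_mul trmxK mulmxA -[_ *m p *m _]mulmxA.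
  by rewrite -mulmxA trmx_delta -colE -rowE !mxE.
by ring.
Qed.

Lemma stiefel_trace p : D p -> \sum_i (p *m p^T) i i = d%:R.
Proof.
move=> pD; rewrite -[LHS]/(\tr (p *m p^T)) mxtrace_mulC.
rewrite (pD : p^T *m p = _) mxtrace_scalar /q -[LHS]mulr_natr.
by rewrite divfK// pnatr_eq0 -lt0n.
Qed.

(** On D the Gram matrix G = p p^T satisfies G^2 = q G, and its trace is d. *)
Lemma stiefel_frobenius p : D p ->
  \sum_i \sum_l (p *m p^T) i l ^+ 2 = q * d%:R.
Proof.
move=> pD; rewrite -(stiefel_trace pD) mulr_sumr.
apply: eq_bigr => i _; transitivity (((p *m p^T) *m (p *m p^T)) i i).
  by rewrite [RHS]mxE; apply: eq_bigr => l _; rewrite expr2 [in X in _ * X]gram_sym.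
rewrite mulmxA -(mulmxA p) (pD : p^T *m p = _).
by rewrite -mulmxA mul_scalar_mx -scalemxAr mxE.
Qed.

(** The d basis vectors have equal second moments, and their sum is the trace of p p^T, which is
    constantly d on D. *)
Lemma haar_second_moment w :
  haar_mean (fun p => enorm (p^T *m w) ^+ 2) = enorm w ^+ 2.
Proof.
have m1E v := haar_moment_scale 1 v; rewrite -[RHS]mulr1 m1E.
congr (_ * _); apply: (@mulfI _ d%:R); first by rewrite pnatr_eq0 -lt0n.
rewrite mulr1 -[RHS](haar_mean_cst d%:R).
transitivity (\sum_(i < d) haar_mean (fun p => enorm (p^T *m delta_mx i 0) ^+ 2)).
  rewrite (eq_bigr (fun=> haar_mean (fun p => enorm (p^T *m e0) ^+ 2))).
    by rewrite sumr_const card_ord mulr_natl.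
  by move=> i _; rewrite m1E enorm_delta expr1n mul1r.
rewrite -haar_mean_sum => [|i]; last exact: haar_bounded_sqr_enorm.
apply: eq_haar_mean => p pD; rewrite -(stiefel_trace pD).
by apply: eq_bigr => i _; rewrite sqr_enorm_tr_delta.
Qed.

Lemma haar_bounded_gram i l : haar_bounded (fun p => (p *m p^T) i l).
Proof.
rewrite (_ : (fun p => _) = (fun p : 'M[R]_(d, r) => \sum_k p i k * p l k)).
  by apply: haar_bounded_sum => k; apply: haar_boundedM; exact: haar_bounded_coord.
by apply/funext => p; rewrite mxE; apply: eq_bigr => k _; rewrite mxE.
Qed.

(* Polarization of the quartic form w |-> E |p^T w|^4, a multiple of |w|^4 by
   invariance. *)
Lemma haar_gram_moment i l :
  haar_mean (fun p => (p *m p^T) i i * (p *m p^T) l l + 2 * (p *m p^T) i l ^+ 2) =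
  (1 + 2 * (i == l)%:R) * haar_mean (fun p => (enorm (p^T *m e0) ^+ 2) ^+ 2).
Proof.
set c := (X in _ = _ * X).
have bG i' l' := haar_bounded_gram i' l'.
have b4 w : haar_bounded (fun p => (enorm (p^T *m w) ^+ 2) ^+ 2).
  by apply: haar_boundedX; exact: haar_bounded_sqr_enorm.
have bF : haar_bounded
  (fun p => (p *m p^T) i i * (p *m p^T) l l + 2 * (p *m p^T) i l ^+ 2).
  apply: haar_boundedD; first exact: haar_boundedM.
  by apply: haar_boundedM; [exact: haar_bounded_cst|exact: haar_boundedX].
have m2E w : haar_mean (fun p => (enorm (p^T *m w) ^+ 2) ^+ 2) = (enorm w ^+ 2) ^+ 2 * c.
  exact: (haar_moment_scale 2 w).
pose w1 : 'cV[R]_d := delta_mx i 0 + 1 *: delta_mx l 0.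
pose w2 : 'cV[R]_d := delta_mx i 0 + (-1) *: delta_mx l 0.
have nE (s : R) : s ^+ 2 = 1 ->
  enorm (delta_mx i 0 + s *: delta_mx l 0 : 'cV[R]_d) ^+ 2 = 2 + 2 * s * (i == l)%:R.
  move=> s2; rewrite sqr_enorm dotvDl !dotvDr !dotvZl !dotvZr !dotv_delta !eqxx.
  rewrite (mulrA s s) -expr2 s2 (eq_sym l i).
  by case: (i == l) => /=; ring.
(* With A, B the diagonal entries at i and l and C the entry (i, l) of p p^T, this is (A + B + 2C)^2
   + (A + B - 2C)^2 = 4 (A B + 2 C^2) + 2 (A^2 + B^2). *)
have : haar_mean (fun p =>
     4 * ((p *m p^T) i i * (p *m p^T) l l + 2 * (p *m p^T) i l ^+ 2)
     + 2 * ((enorm (p^T *m delta_mx i 0) ^+ 2) ^+ 2 +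
            (enorm (p^T *m delta_mx l 0) ^+ 2) ^+ 2)) =
   haar_mean (fun p => (enorm (p^T *m w1) ^+ 2) ^+ 2 + (enorm (p^T *m w2) ^+ 2) ^+ 2).
  apply: eq_haar_mean => p _.
  rewrite /w1 /w2 !sqr_enorm_tr_deltaD ?sqrrN ?expr1n// !sqr_enorm_tr_delta; ring.
pose bil := haar_boundedD (b4 (delta_mx i 0)) (b4 (delta_mx l 0)).
rewrite (haar_meanD (haar_boundedM (haar_bounded_cst 4) bF)
  (haar_boundedM (haar_bounded_cst 2) bil)).
rewrite (haar_meanZ 4 bF) (haar_meanZ 2 bil).
rewrite (haar_meanD (b4 (delta_mx i 0)) (b4 (delta_mx l 0))) (haar_meanD (b4 w1) (b4 w2)).
rewrite !m2E !enorm_delta !nE ?sqrrN ?expr1n//.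
case: (i == l) => /= h; move: h; set X := haar_mean _ => h.
  by apply: (@mulfI _ 4) => //; lra.
by apply: (@mulfI _ 4) => //; lra.
Qed.

(** Summing [haar_gram_moment] over all i and l determines the constant: the integrand becomes (tr
    G)^2 + 2 |G|_F^2 with G = p p^T, constantly d^2 + 2 q d on D, while the right-hand sides add up
    to d (d + 2) c. *)
Lemma haar_fourth_moment w :
  haar_mean (fun p => (enorm (p^T *m w) ^+ 2) ^+ 2) =
  (d%:R + 2 * q) / (d%:R + 2) * (enorm w ^+ 2) ^+ 2.
Proof.
rewrite (haar_moment_scale 2) mulrC; congr (_ * _).
set c := haar_mean _.
have dp : (0 : R) < d%:R by rewrite ltr0n.
apply: (@mulIf _ (d%:R * (d%:R + 2))); first by rewrite mulf_neq0 ?gt_eqF ?addr_gt0.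
have -> : (d%:R + 2 * q) / (d%:R + 2) * (d%:R * (d%:R + 2)) = d%:R ^+ 2 + 2 * (q * d%:R).
  by field; rewrite gt_eqF// addr_gt0.
have bG i' l' := haar_bounded_gram i' l'.
have bF i l : haar_bounded
  (fun p => (p *m p^T) i i * (p *m p^T) l l + 2 * (p *m p^T) i l ^+ 2).
  apply: haar_boundedD; first exact: haar_boundedM.
  by apply: haar_boundedM; [exact: haar_bounded_cst|exact: haar_boundedX].
rewrite -[RHS]haar_mean_cst.
transitivity (haar_mean (fun p => \sum_i \sum_l
    ((p *m p^T) i i * (p *m p^T) l l + 2 * (p *m p^T) i l ^+ 2))); last first.
  apply: eq_haar_mean => p pD.
  rewrite -(stiefel_frobenius pD) -[in d%:R ^+ 2](stiefel_trace pD) expr2 big_distrlr /=.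
  rewrite mulr_sumr -big_split; apply: eq_bigr => i _ /=.
  by rewrite mulr_sumr -big_split.
rewrite haar_mean_sum => [|i]; last exact: haar_bounded_sum.
under eq_bigr do rewrite haar_mean_sum//.
under eq_bigr do under eq_bigr do rewrite haar_gram_moment.
rewrite (eq_bigr (fun=> (d%:R + 2) * c)); last first.
  move=> i _; rewrite -mulr_suml; congr (_ * _).
  rewrite big_split /= sumr_const card_ord -mulr_sumr (bigD1 i)//= eqxx.
  rewrite big1 ?addr0 ?mulr1// => l li.
  by rewrite eq_sym (negbTE li).
by rewrite sumr_const card_ord -mulr_natl; ring.
Qed.
End HaarMoments.

(* Tangent at y = k; it turns second and fourth moments into a bound on the mean. *)
Lemma quartic_lower_bound {R : realType} (k y : R) : 0 < k -> 0 <= y ->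
  3 / (2 * k) * y ^+ 2 - y ^+ 4 / (2 * k ^+ 3) <= y.
Proof.
move=> k0 y0; rewrite -subr_ge0.
have -> : y - (3 / (2 * k) * y ^+ 2 - y ^+ 4 / (2 * k ^+ 3)) =
    y / (2 * k ^+ 3) * ((y - k) ^+ 2 * (y + 2 * k)).
  by field; rewrite gt_eqF.
apply: mulr_ge0; first by rewrite divr_ge0// mulr_ge0// exprn_ge0// ltW.
by rewrite mulr_ge0 ?sqr_ge0// addr_ge0// mulr_ge0// ltW.
Qed.

(** * The Laplace transform of |P^T g| *)

Section HaarLaplace.
Context {R : realType} {d r : nat} (r_gt0 : (0 < r)%N) (rd : (r <= d)%N).
Variable nu : probability (borelMx R d r) R.
Let q : R := d%:R / r%:R.
Local Notation D := (@scaled_stiefel R d r).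

Hypothesis nu_invariant : forall U : 'M[R]_d, orthogonal_group U ->
  forall A : set (borelMx R d r), measurable A -> nu (mulmx U @^-1` A) = nu A.
Hypothesis nu_stiefel : nu D = 1%E.

Lemma measurable_enorm_tr (g : 'cV[R]_d) :
  measurable_fun setT (fun p : borelMx R d r => enorm ((p : 'M[R]_(d, r))^T *m g)).
Proof.
rewrite (_ : (fun p => _) = (fun p : borelMx R d r =>
    Num.sqrt (enorm ((p : 'M[R]_(d, r))^T *m g) ^+ 2))); last first.
  by apply/funext => p; rewrite sqrtr_sqr ger0_norm// enorm_ge0.
apply: measurableT_comp.
  by apply: continuous_measurable_fun; exact: sqrt_continuous.
by have [] := @haar_bounded_sqr_enorm R d r g.
Qed.

Lemma haar_bounded_laplace (lam : R) (g : 'cV[R]_d) : 0 <= lam ->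
  haar_bounded (fun p : 'M[R]_(d, r) => expR (- (lam * enorm (p^T *m g)))).
Proof.
move=> lam0; split.
  apply: measurableT_comp; first exact: measurable_expR.
  apply: measurableT_comp => //; apply: measurable_funM => //.
  exact: measurable_enorm_tr.
exists 1 => p _; rewrite ger0_norm ?expR_ge0// -expR0 ler_expR oppr_le0.
by rewrite mulr_ge0// enorm_ge0.
Qed.

Lemma integral_haar_mean f : haar_bounded f -> (forall p, 0 <= f p) ->
  (\int[nu]_p (f p)%:E)%E = (haar_mean nu f)%:E.
Proof.
move=> bf f0; have mD := @measurable_stiefel R d r.
have nuDc : nu (~` D) = 0%E.
  have := probability_setC nu mD.
  by move=> ->; rewrite nu_stiefel subee.
rewrite (@ge0_negligible_integral _ _ _ nu setT (~` D))//; first last.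
- by move=> p _; rewrite lee_fin.
- by apply/measurable_EFinP; case: bf.
- exact: measurableC.
rewrite setTD setCK /haar_mean /Rintegral fineK//.
exact/integrable_fin_num/haar_bounded_integrable.
Qed.

(** With s = lam |g|, the second and fourth moments bound the transform by 1 - s (1 / k - s / 2).
    The assumption on s gives s / 2 <= tau / (3 q), and [tau_moment_bound] then gives 1 / k - s / 2
    >= tau / 2. *)
Lemma haar_laplace (lam : R) (g : 'cV[R]_d) : 0 <= lam ->
  lam * enorm g <= 2 * tau d r / (3 * q) ->
  (\int[nu]_p (expR (- (lam * enorm ((p : 'M[R]_(d, r))^T *m g))))%:E <=
   (expR (- (lam * enorm g * tau d r / 2)))%:E)%E.
Proof.
move=> lam0 hlam; set N := enorm g in hlam *.
have bL := haar_bounded_laplace g lam0.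
rewrite (integral_haar_mean bL) => [|p]; last exact: expR_ge0.
rewrite lee_fin.
have [N0|N0] := eqVneq N 0.
  rewrite N0 mulr0 !mul0r oppr0 expR0 -[X in _ <= X](haar_mean_cst nu_stiefel 1).
  apply: (le_haar_mean nu bL (haar_bounded_cst 1)) => p _.
  by rewrite -expR0 ler_expR oppr_le0 mulr_ge0// enorm_ge0.
have Np : 0 < N by rewrite lt_def N0 enorm_ge0.
have dp : (0 : R) < d%:R by rewrite ltr0n (leq_trans r_gt0).
have qp : 0 < q by rewrite divr_gt0// ltr0n.
pose c : R := (d%:R + 2 * q) / (d%:R + 2).
have cp : 0 < c by rewrite divr_gt0// addr_gt0// mulr_gt0.
(* Here c = E y^4 for y = |P^T g| / |g|. Tangency at k bounds E y below by 3 / (2 k) - c / (2 k^3);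
   k = sqrt c maximizes this expression, with value 1 / k. *)
pose k := Num.sqrt c.
have kp : 0 < k by rewrite sqrtr_gt0.
have k2 : c = k ^+ 2 by rewrite sqr_sqrtr// ltW.
have tau0 : 0 <= tau d r :> R by rewrite ltW// tau_gt0// (leq_trans r_gt0).
have ktau : tau d r * (2^-1 + (3 * q)^-1) <= k^-1.
  have := @tau_moment_bound R d r r_gt0 rd; rewrite -/q => h.
  have t0 : 0 <= tau d r * (2^-1 + (3 * q)^-1).
    by rewrite mulr_ge0// addr_ge0// invr_ge0 mulr_ge0// ltW.
  rewrite -(@ler_pM2r _ k)// mulVf ?gt_eqF//.
  have tk0 : 0 <= tau d r * (2^-1 + (3 * q)^-1) * k by rewrite mulr_ge0// ltW.
  rewrite -(@expr_le1 _ 2 _ isT tk0) (exprMn _ _ k) -k2 /c mulrA.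
  by rewrite ler_pdivrMr ?mul1r// addr_gt0.
(* Coefficients of |p^T g|^2 and |p^T g|^4 after inserting the quartic bound, tangent at k N since
   |p^T g| = N y, into the linear term of 1 - z + z^2 / 2. *)
pose a := lam ^+ 2 / 2 - lam * (3 / (2 * (k * N))).
pose b := lam / (2 * (k * N) ^+ 3).
have b2 := @haar_bounded_sqr_enorm R d r g.
have b4 := haar_boundedX 2 b2.
have ba := haar_boundedM (haar_bounded_cst a) b2.
have bb := haar_boundedM (haar_bounded_cst b) b4.
have kN : 0 < k * N by rewrite mulr_gt0.
apply: (@le_trans _ _ (haar_mean nu (fun p => 1 + (a * enorm (p^T *m g) ^+ 2 +
   b * (enorm (p^T *m g) ^+ 2) ^+ 2)))).
  apply: (le_haar_mean nu bL).
    by apply: haar_boundedD; [exact: haar_bounded_cst|exact: haar_boundedD].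
  move=> p _; set y := enorm _; have y0 : 0 <= y by exact: enorm_ge0.
  apply: le_trans (expRN_le_quadratic (mulr_ge0 lam0 y0)) _.
  have := ler_wpM2l lam0 (quartic_lower_bound kN y0); rewrite -exprM muln2 /= => h.
  rewrite -subr_ge0; rewrite -subr_ge0 in h; apply: le_trans h _.
  by rewrite le_eqVlt; apply/orP; left; apply/eqP; rewrite /a /b; field; rewrite !gt_eqF.
rewrite (haar_meanD nu (haar_bounded_cst 1) (haar_boundedD ba bb)).
rewrite (haar_meanD nu ba bb) (haar_meanZ nu a b2) (haar_meanZ nu b b4).
rewrite haar_mean_cst// (haar_second_moment r_gt0 rd nu_invariant nu_stiefel).
rewrite (haar_fourth_moment r_gt0 rd nu_invariant nu_stiefel).
rewrite -/q -/c -/N k2.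
set s := lam * N in hlam *.
have s0 : 0 <= s by rewrite mulr_ge0// ltW.
have -> : 1 + (a * N ^+ 2 + b * (k ^+ 2 * (N ^+ 2) ^+ 2)) = 1 - s * (k^-1 - s / 2).
  by rewrite /a /b /s; field; rewrite !gt_eqF.
apply: le_trans (expR_ge1Dx _); rewrite lerD2l lerN2 -mulrA ler_wpM2l//.
have : s / 2 <= tau d r * (3 * q)^-1.
  rewrite ler_pdivrMr//; apply: le_trans hlam _.
  by rewrite le_eqVlt; apply/orP; left; apply/eqP; field; rewrite gt_eqF.
by move: ktau; rewrite mulrDr; lra.
Qed.

End HaarLaplace.

(** * Invariance and support of the law of a Haar matrix *)

Section HaarMatrixLaw.
Context {R : realType} {d r : nat} (r_gt0 : (0 < r)%N) (hrd : (r <= d)%N).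
Context {disp : measure_display} {Omega : measurableType disp}
  (Pr : probability Omega R) (X : {RV Pr >-> borelMx R d r}).
Hypothesis haarX : is_haar_matrix hrd X.

Lemma measurable_scaled_first_cols :
  measurable_fun setT (scaled_first_cols hrd : borelMx R d d -> borelMx R d r).
Proof.
apply: measurable_fun_borelMx => i j.
rewrite (_ : (fun p => _) = (fun p : borelMx R d d => Num.sqrt (d%:R / r%:R) *
   (p : 'M[R]_d) i (widen_ord hrd j))); last first.
  by apply/funext => p; rewrite !mxE.
by apply: measurable_funM => //; exact: measurable_borelMx_coord.
Qed.

Lemma haar_matrix_invariant (U : 'M[R]_d) : orthogonal_group U ->
  forall A : set (borelMx R d r), measurable A ->
  distribution Pr X (mulmx U @^-1` A) = distribution Pr X A.
Proof.
move=> oU A mA; have [mu [[_ muU] muE]] := haarX.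
have mUA : measurable (mulmx U @^-1` A : set (borelMx R d r)).
  by rewrite -[X in measurable X]setTI; exact: measurable_mulmx.
rewrite !muE// -[RHS](muU U oU); last first.
  by rewrite -[X in measurable X]setTI; exact: measurable_scaled_first_cols.
congr (mu _); apply/seteqP; split=> Q /=;
  by rewrite /scaled_first_cols -scalemxAr mulmx_colsub.
Qed.

Lemma haar_matrix_stiefel : distribution Pr X (@scaled_stiefel R d r) = 1%E.
Proof.
have [mu [[muO _] muE]] := haarX.
have mD := @measurable_stiefel R d r.
have mS : measurable (scaled_first_cols hrd @^-1` (@scaled_stiefel R d r)
    : set (borelMx R d d)).
  by rewrite -[X in measurable X]setTI; exact: measurable_scaled_first_cols.
rewrite muE//; apply/eqP; rewrite eq_le probability_le1//=.
have d_gt0 : (0 < d)%N by exact: leq_trans hrd.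
(* For r = d the ratio q is 1 and the scaled Stiefel set is O(d) itself. *)
have mO : measurable (@orthogonal_group R d : set (borelMx R d d)).
  have := @measurable_stiefel R d d; rewrite /scaled_stiefel divff//.
  by rewrite pnatr_eq0 -lt0n.
rewrite -muO; apply: le_measure; rewrite ?inE// => Q oQ.
rewrite /scaled_stiefel /= /scaled_first_cols.
have qge0 : 0 <= d%:R / r%:R :> R by rewrite divr_ge0.
rewrite [(_ *: _)^T]linearZ /= -scalemxAl -scalemxAr scalerA -expr2 sqr_sqrtr//.
rewrite -scalemx1; congr (_ *: _).
apply/matrixP => i j; rewrite !mxE.
have := congr1 (fun M : 'M[R]_d => M (widen_ord hrd i) (widen_ord hrd j)) oQ.
by rewrite !mxE => <-; apply: eq_bigr => k _; rewrite !mxE.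
Qed.

End HaarMatrixLaw.

(** * Descent of normalized gradient steps *)

Section Descent.
Context {R : realType} {n : nat}.
Variables (F : 'cV[R]_n -> R) (L : R).
Hypotheses (hdiff : forall x, differentiable F x) (L_gt0 : 0 < L)
  (hsmooth : smooth L F) (hbound : has_lbound (range F)).
Implicit Types (x y h : 'cV[R]_n).

Lemma derive_dotv x h : 'D_h F x = dotv (grad F x) h.
Proof.
rewrite deriveE// /dotv.
have -> : h = \sum_i h i 0 *: delta_mx i 0.
  by rewrite [LHS]matrix_sum_delta; apply: eq_bigr => i _; rewrite big_ord1.
rewrite linear_sum /=; apply: eq_bigr => i _.
rewrite linearZ /= -deriveE// mxE mulrC; congr (_ * _).
rewrite summxE (bigD1 i)//= big1 => [|j ji].
  by rewrite !mxE !eqxx mulr1 addr0.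
by rewrite !mxE eq_sym (negbTE ji) mulr0.
Qed.

Lemma is_derive_line x h (t : R) :
  is_derive t 1 (fun s : R => F (x + s *: h)) (dotv (grad F (x + t *: h)) h).
Proof.
(* The difference quotient in the line parameter is the one of F in direction h at x + t h, so the
   derivative transfers without a chain rule. *)
have E : (fun s : R => s^-1 *: (((fun s : R => F (x + s *: h)) \o shift t) (s *: (1 : R))
     - F (x + t *: h))) =
   (fun s : R => s^-1 *: ((F \o shift (x + t *: h)) (s *: h) - F (x + t *: h))).
  apply/funext => s /=; congr (_ *: (F _ - _)).
  by rewrite scalerDl scaler1 addrCA addrA.
have dF : derivable F (x + t *: h) h by exact: diff_derivable.
split; first by rewrite /derivable E.
by rewrite /derive E -derive_dotv.
Qed.

(** Instead of integrating the gradient along the segment, F minus the quadratic model is shown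
    nonincreasing on [0, 1]: its derivative <grad F (x + t h) - grad F x, h> - t L |h|^2 is
    nonpositive by Cauchy-Schwarz and smoothness. *)
Lemma descent_lemma x h :
  F (x + h) <= F x + dotv (grad F x) h + L / 2 * enorm h ^+ 2.
Proof.
pose a := dotv (grad F x) h; pose b := L * enorm h ^+ 2.
pose phi (t : R) := F (x + t *: h) - (t * a + t ^+ 2 / 2 * b).
have dphi (t : R) : is_derive t 1 phi (dotv (grad F (x + t *: h)) h - (a + t * b)).
  apply: is_deriveB; first exact: is_derive_line.
  apply: is_derive_eq.
  by rewrite !scaler0 /GRing.scale /=; field.
have : phi 1 <= phi 0.
  apply: (@ler0_derive1_nincr _ phi 0 1) => //.
  - move=> t t01; rewrite derive1E; have [_ ->] := dphi t.
    have t0 : 0 <= t by move: t01; rewrite in_itv /= => /andP[/ltW].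
    rewrite subr_le0 -lerBlDl -dotvNl -dotvDl.
    apply: le_trans (dotv_le _ _) _; apply: (@le_trans _ _ (L * enorm (t *: h) * enorm h)).
      rewrite ler_wpM2r ?enorm_ge0//.
      by have := hsmooth (x + t *: h) x; rewrite addrAC subrr add0r.
    by rewrite enormZ ger0_norm// /b le_eqVlt; apply/orP; left; apply/eqP; ring.
  - by apply: derivable_within_continuous => t _; have [] := dphi t.
rewrite /phi scale1r scale0r addr0 expr0n /= => h1.
by rewrite -/a; move: h1; rewrite /b expr1n; lra.
Qed.

(** A gradient step of length 1 / L decreases F by at least |grad F x|^2 / (2 L) and cannot go below
    the infimum. *)
Lemma sqr_enorm_grad_le x : enorm (grad F x) ^+ 2 <= 2 * (F x - inf (range F)) * L.
Proof.
have Li : `|L^-1| = L^-1 by rewrite ger0_norm// invr_ge0 ltW.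
have := descent_lemma x (- (L^-1 *: grad F x)).
rewrite dotvNr dotvZr -sqr_enorm enormN enormZ Li => h.
have : inf (range F) <= F (x - L^-1 *: grad F x).
  by apply: ge_inf => //; exists (x - L^-1 *: grad F x).
move: h; set N := enorm _; move=> h1 h2.
have h3 : N ^+ 2 * (L^-1 / 2) <= F x - inf (range F).
  have e : L / 2 * (L^-1 * N) ^+ 2 = N ^+ 2 * (L^-1 / 2) by field; rewrite gt_eqF.
  have e' : L^-1 * N ^+ 2 = N ^+ 2 * (L^-1 / 2) * 2 by field; rewrite gt_eqF.
  by move: h1; rewrite e e'; lra.
have -> : N ^+ 2 = (N ^+ 2 * (L^-1 / 2)) * (2 * L) by field; rewrite gt_eqF.
have -> : 2 * (F x - inf (range F)) * L = (F x - inf (range F)) * (2 * L) by ring.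
by rewrite ler_wpM2r// mulr_ge0// ltW.
Qed.

Lemma inf_range_le x : inf (range F) <= F x.
Proof. by apply: ge_inf => //; exists x. Qed.

End Descent.

Section NormalizedDescent.
Context {R : realType} {d r : nat}.
Let q : R := d%:R / r%:R.
Local Notation D := (@scaled_stiefel R d r).

Lemma dotv_ngd_direction (p : 'M[R]_(d, r)) g :
  dotv g (ngd_direction p g) = enorm (p^T *m g).
Proof.
rewrite /ngd_direction; case: ifPn => [/eqP ->|z0].
  by rewrite enorm0 -(scale0r g) dotvZr mul0r.
rewrite dotvZr dotvE !mulmxA -mulmxA -[g^T *m p]trmxK trmx_mul trmxK -dotvE.
by rewrite -sqr_enorm expr2 mulKf// enorm_eq0.
Qed.

Lemma sqr_enorm_ngd_direction (p : 'M[R]_(d, r)) g : D p ->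
  enorm (ngd_direction p g) ^+ 2 <= q.
Proof.
move=> pD; rewrite /ngd_direction; case: ifPn => [_|z0].
  by rewrite enorm0 expr0n divr_ge0.
have z1 : enorm (p^T *m g) != 0 by rewrite enorm_eq0.
rewrite sqr_enorm dotvZl dotvZr -mulmxA dotvE trmx_mul mulmxA -(mulmxA _ p^T p).
rewrite (pD : p^T *m p = q%:M) scalar_mxC mul_scalar_mx -scalemxAl mxE -dotvE -sqr_enorm.
by rewrite le_eqVlt; apply/orP; left; apply/eqP; field.
Qed.

Variables (F : 'cV[R]_d -> R) (L : R).
Hypotheses (hdiff : forall x, differentiable F x) (L_gt0 : 0 < L)
  (hsmooth : smooth L F) (hbound : has_lbound (range F)).
Variables (s : R) (s_ge0 : 0 <= s) (x0 : 'cV[R]_d) (P : nat -> 'M[R]_(d, r)).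
Local Notation x := (rs_ngd F s x0 P).

Lemma rs_ngd_descent k : (forall j, (j < k)%N -> D (P j)) ->
  s * \sum_(0 <= j < k) enorm ((P j)^T *m grad F (x j)) <=
  F x0 - F (x k) + k%:R * (L / 2 * s ^+ 2 * q).
Proof.
elim: k => [|k ih] PD; first by rewrite big_geq// mulr0 mul0r addr0 subrr.
have {}ih := ih (fun j jk => PD j (ltnW jk)).
rewrite big_nat_recr//= mulrDr.
have := descent_lemma hdiff hsmooth (x k) (- (s *: ngd_direction (P k) (grad F (x k)))).
rewrite dotvNr dotvZr dotv_ngd_direction enormN enormZ exprMn ger0_norm//.
have : L / 2 * (s ^+ 2 * enorm (ngd_direction (P k) (grad F (x k))) ^+ 2) <=
    L / 2 * s ^+ 2 * q.
  rewrite -[X in _ <= X]mulrA; apply: ler_wpM2l; first by rewrite divr_ge0// ltW.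
  by apply: ler_wpM2l; [exact: sqr_ge0|]; apply: sqr_enorm_ngd_direction; exact: PD.
by rewrite -(natr1 k) mulrDl mul1r; lra.
Qed.

(** Each displacement has norm at most s sqrt q, so by smoothness the gradient moves by at most L s
    sqrt q per step from its initial bound. At k = T this ceiling is the M that limits lam. *)
Lemma enorm_grad_rs_ngd k : (forall j, (j < k)%N -> D (P j)) ->
  enorm (grad F (x k)) <=
  Num.sqrt (2 * (F x0 - inf (range F)) * L) + k%:R * (L * s * Num.sqrt q).
Proof.
elim: k => [|k ih] PD.
  rewrite mul0r addr0 /= -(ger0_norm (enorm_ge0 _)) -sqrtr_sqr ler_wsqrtr//.
  exact: sqr_enorm_grad_le.
have {}ih := ih (fun j jk => PD j (ltnW jk)).
rewrite -(subrK (grad F (x k)) (grad F (x k.+1))).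
apply: le_trans (ler_enormD _ _) _.
have -> : k.+1%:R * (L * s * Num.sqrt q) =
    k%:R * (L * s * Num.sqrt q) + L * s * Num.sqrt q.
  by rewrite -(natr1 k) mulrDl mul1r.
rewrite addrA [X in X <= _]addrC; apply: lerD; first exact: ih.
apply: le_trans (hsmooth _ _) _.
rewrite /= addrAC subrr add0r enormN enormZ ger0_norm// mulrA ler_wpM2l//.
  by rewrite mulr_ge0// ltW.
rewrite -(ger0_norm (enorm_ge0 _)) -sqrtr_sqr ler_wsqrtr//.
by apply: sqr_enorm_ngd_direction; exact: PD.
Qed.

End NormalizedDescent.

(** * The exponential supermartingale *)

Section MeasurableVectorFunctions.
Context {R : realType} {dT : measure_display} {S : measurableType dT}.

Lemma measurable_mx_coord {m n : nat} (f : S -> borelMx R m n) i j :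
  measurable_fun setT f ->
  measurable_fun setT (fun t => (f t : 'M[R]_(m, n)) i j).
Proof.
by move=> mf; apply: (measurableT_comp (measurable_borelMx_coord i j) mf).
Qed.

Lemma measurable_enorm {n : nat} (g : S -> 'cV[R]_n) :
  (forall i, measurable_fun setT (fun t => g t i 0)) ->
  measurable_fun setT (fun t => enorm (g t)).
Proof.
move=> mg; apply: (measurableT_comp (f := @Num.sqrt R)).
  by apply: continuous_measurable_fun; exact: sqrt_continuous.
apply: measurable_sum => i; apply: measurable_funX; exact: mg.
Qed.

Lemma measurable_mulmx_coord {m n k : nat} (f : S -> 'M[R]_(m, n))
    (g : S -> 'M[R]_(n, k)) :
  (forall i j, measurable_fun setT (fun t => f t i j)) ->
  (forall i j, measurable_fun setT (fun t => g t i j)) ->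
  forall i j, measurable_fun setT (fun t => (f t *m g t) i j).
Proof.
move=> mf mg i j; rewrite (_ : (fun t => _) = (fun t => \sum_l f t i l * g t l j)).
  by apply: measurable_sum => l; exact: measurable_funM.
by apply/funext => t; rewrite mxE.
Qed.

Lemma measurable_trmx_coord {m n : nat} (f : S -> 'M[R]_(m, n)) :
  (forall i j, measurable_fun setT (fun t => f t i j)) ->
  forall i j, measurable_fun setT (fun t => (f t)^T i j).
Proof.
move=> mf i j; rewrite (_ : (fun t => _) = (fun t => f t j i))//.
by apply/funext => t; rewrite mxE.
Qed.

(* The convention 0^-1 = 0 absorbs the case distinction of [ngd_direction]. *)
Lemma ngd_directionE {d r : nat} (p : 'M[R]_(d, r)) g :
  ngd_direction p g = (enorm (p^T *m g)) `^ (-1) *: (p *m (p^T *m g)).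
Proof.
rewrite powR_inv1 ?enorm_ge0// /ngd_direction mulmxA; case: ifPn => [/eqP ->|//].
by rewrite enorm0 invr0 scale0r.
Qed.

Lemma measurable_ngd_direction {d r : nat} (p : S -> 'M[R]_(d, r))
    (g : S -> 'cV[R]_d) :
  (forall i j, measurable_fun setT (fun t => p t i j)) ->
  (forall i j, measurable_fun setT (fun t => g t i j)) ->
  forall i j, measurable_fun setT (fun t => ngd_direction (p t) (g t) i j).
Proof.
move=> mp mg i j; rewrite (_ : (fun t => _) = (fun t => (enorm ((p t)^T *m g t)) `^ (-1) *
    (p t *m ((p t)^T *m g t)) i j)); last first.
  by apply/funext => t; rewrite ngd_directionE mxE.
have mpg i' j' : measurable_fun setT (fun t => ((p t)^T *m g t) i' j').
  by apply: measurable_mulmx_coord => // ? ?; exact: measurable_trmx_coord.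
apply: measurable_funM; last exact: measurable_mulmx_coord.
apply: (measurableT_comp (measurable_powR (-1))).
by apply: measurable_enorm => i'; exact: mpg.
Qed.

End MeasurableVectorFunctions.

Lemma continuous_grad {R : realType} {n : nat} (F : 'cV[R]_n -> R) (L : R) i :
  0 < L -> smooth L F -> continuous (fun x => grad F x i 0).
Proof.
move=> L0 hF x A /nbhs_ballP[e /= e0 eA].
have le_enorm (z : 'cV[R]_n) j : `|z j 0| <= enorm z.
  rewrite -sqrtr_sqr ler_wsqrtr// (bigD1 j)//= lerDl.
  by apply: sumr_ge0 => k _; rewrite sqr_ge0.
have enorm_le (z : 'cV[R]_n) (c : R) : 0 <= c -> (forall j, `|z j 0| <= c) ->
    enorm z <= n%:R * c.
  move=> c0 zc; rewrite -[X in _ <= X]ger0_norm ?mulr_ge0// -sqrtr_sqr ler_wsqrtr//.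
  apply: (@le_trans _ _ (\sum_(j < n) c ^+ 2)).
    by apply: ler_sum => j _; rewrite -real_normK ?num_real// lerXn2r ?nnegrE.
  rewrite sumr_const card_ord exprMn -[leLHS]mulr_natl.
  apply: ler_wpM2r; first exact: sqr_ge0.
  by rewrite -natrX ler_nat; case: (n) => // k; rewrite leq_pmulr.
(* Passing from the sup norm to the Euclidean norm costs a factor n; dividing by n + 1 keeps the
   radius defined at n = 0 and makes the final inequality strict. *)
have dp : 0 < e / (L * (n%:R + 1)) by rewrite divr_gt0// mulr_gt0// ltr_wpDl.
apply/nbhs_ballP; exists (e / (L * (n%:R + 1))) => //= y [_ xy].
apply: eA; rewrite /ball /=.
have -> : grad F x i 0 - grad F y i 0 = (grad F x - grad F y) i 0 by rewrite !mxE.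
apply: le_lt_trans (le_enorm _ _) _; apply: le_lt_trans (hF _ _) _.
apply: (@le_lt_trans _ _ (L * (n%:R * (e / (L * (n%:R + 1)))))).
  apply: ler_wpM2l; first exact: ltW.
  apply: enorm_le => [|j]; first exact: ltW.
  by rewrite !mxE; have := xy j 0; rewrite /ball /= => /ltW.
have np : 0 < n%:R + 1 :> R by rewrite ltr_wpDl.
have -> : L * (n%:R * (e / (L * (n%:R + 1)))) = e * (n%:R / (n%:R + 1)).
  by field; rewrite !gt_eqF.
by rewrite gtr_pMr// ltr_pdivrMr// mul1r ltrDl.
Qed.

Lemma markov_complement {R : realType} {disp : measure_display}
    {Omega : measurableType disp} (Pr : probability Omega R) (W : Omega -> R) (a : R) :
  0 < a -> measurable_fun setT W -> (forall w, 0 <= W w) ->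
  (\int[Pr]_w (W w)%:E <= 1)%E ->
  (Pr [set w | a^-1 <= W w]%R <= a%:E)%E.
Proof.
move=> a0 mW W0 intW.
have ai0 : 0 < a^-1 by rewrite invr_gt0.
have := @le_integral_abse _ _ _ Pr setT measurableT (fun w => (W w)%:E) a^-1 _ ai0.
have -> : setT `&` [set w | (a^-1%:E <= `|(W w)%:E|)%E] = [set w | a^-1 <= W w].
  by rewrite setTI; apply/seteqP; split=> w /=; rewrite lee_fin ger0_norm.
move=> /(_ _)/wrap[]; first exact/measurable_EFinP.
have -> : (\int[Pr]_x `|(W x)%:E| = \int[Pr]_x (W x)%:E)%E.
  by apply: eq_integral => w _; rewrite gee0_abs// lee_fin.
move=> /le_trans /(_ intW) h.
by move: h; rewrite lee_pdivrMl// mule1.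
Qed.

Lemma probability_ge_of_subset {R : realType} {disp : measure_display}
    {Omega : measurableType disp} (Pr : probability Omega R)
    (B A : set Omega) (E : nat -> set Omega) (a : R) :
  measurable B -> measurable A -> (forall k, measurable (E k)) ->
  (forall k, Pr (E k) = 1%E) -> (Pr A <= a%:E)%E ->
  ~` A `&` \bigcap_k E k `<=` B -> ((1 - a)%:E <= Pr B)%E.
Proof.
move=> mB mA mE PE PA sub.
have mEc k : measurable (~` E k) by exact: measurableC.
have nE : Pr (\bigcup_k ~` E k) = 0%E.
  apply: measure_negligible; first exact: bigcupT_measurable.
  apply: negligible_bigcup => k; apply/negligibleP => //.
  by have := probability_setC Pr (mE k); rewrite PE subee.
have PB : (Pr (~` B) <= a%:E)%E.
  apply: (@le_trans _ _ (Pr (A `|` \bigcup_k ~` E k))).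
    apply: le_measure; rewrite ?inE; [exact: measurableC| |].
      by apply: measurableU => //; exact: bigcupT_measurable.
    move=> w nB; apply: contrapT => /not_orP[nA nU]; apply: nB; apply: sub.
    split=> // k _; apply: contrapT => nEk; apply: nU; by exists k.
  apply: (@le_trans _ _ (Pr A + Pr (\bigcup_k ~` E k))%E).
    by apply: measureU2 => //; exact: bigcupT_measurable.
  by rewrite nE adde0.
have := probability_setC Pr mB; move: PB.
rewrite -(fineK (fin_num_measure Pr _ mB)) => /[swap] -> .
by rewrite -EFinB !lee_fin; lra.
Qed.

Section ExponentialSupermartingale.
Context {R : realType} {d r : nat} (r_gt0 : (0 < r)%N) (hrd : (r <= d)%N).
Let q : R := d%:R / r%:R.
Let t : R := tau d r.
Variables (F : 'cV[R]_d -> R) (L : R).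
Hypotheses (L_gt0 : 0 < L) (hsmooth : smooth L F).
Context {disp : measure_display} {Omega : measurableType disp}
  {Pr : probability Omega R}.
Variables (P : nat -> {RV Pr >-> borelMx R d r}) (hP : iid_haar_matrices hrd P).
Variables (s : R) (x0 : 'cV[R]_d).
Variables (lam M : R) (lam_ge0 : 0 <= lam) (lamM : lam * M <= 2 * t / (3 * q)).
Let x (k : nat) (w : Omega) := rs_ngd F s x0 (fun j => P j w) k.

(* The truncation at gradient norm M makes the conditional estimate hold for every
   gradient; the gradients along the trajectory are bounded only almost surely. *)
Definition laplace_factor (p : 'M[R]_(d, r)) (g : 'cV[R]_d) : R :=
  if enorm g <= M then expR (lam * (t / 2 * enorm g - enorm (p^T *m g))) else 1.

Definition laplace_product (k : nat) (w : Omega) : R :=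
  \prod_(0 <= j < k) laplace_factor (P j w) (grad F (x j w)).

Lemma laplace_factor_ge0 p g : 0 <= laplace_factor p g.
Proof. by rewrite /laplace_factor; case: ifP => // _; exact: expR_ge0. Qed.

Lemma laplace_product_ge0 k w : 0 <= laplace_product k w.
Proof. by apply: prodr_ge0 => j _; exact: laplace_factor_ge0. Qed.

Lemma measurable_laplace_factor {dT} {S : measurableType dT}
    (p : S -> 'M[R]_(d, r)) (g : S -> 'cV[R]_d) :
  (forall i j, measurable_fun setT (fun z => p z i j)) ->
  (forall i j, measurable_fun setT (fun z => g z i j)) ->
  measurable_fun setT (fun z => laplace_factor (p z) (g z)).
Proof.
move=> mp mg; have mng : measurable_fun setT (fun z => enorm (g z)).
  by apply: measurable_enorm => i; exact: mg.
apply: measurable_fun_ifT.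
- by apply: measurable_fun_ler.
- apply: measurableT_comp => //; apply: measurable_funM => //.
  apply: measurable_funB; first exact: measurable_funM.
  apply: measurable_enorm => i; apply: measurable_mulmx_coord => //.
  exact: measurable_trmx_coord.
- exact: measurable_cst.
Qed.

Lemma integral_laplace_factor k g :
  (\int[distribution Pr (P k)]_p (laplace_factor p g)%:E <= 1)%E.
Proof.
rewrite /laplace_factor; have [gM|gM] := boolP (enorm g <= M); last first.
  by rewrite integral_cst//= probability_setT mul1e.
have haar := hP.2 k.
have -> : (\int[distribution Pr (P k)]_p
     (expR (lam * (t / 2 * enorm g - enorm ((p : 'M[R]_(d, r))^T *m g))))%:E =
   (expR (lam * enorm g * t / 2))%:E *
   \int[distribution Pr (P k)]_p
     (expR (- (lam * enorm ((p : 'M[R]_(d, r))^T *m g))))%:E)%E.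
  rewrite -ge0_integralZl_EFin//=; do ?[by move=> p _; rewrite lee_fin expR_ge0].
    apply: eq_integral => p _; rewrite -EFinM -expRD; congr (expR _)%:E.
    by ring.
  by apply/measurable_EFinP; have [] := @haar_bounded_laplace R d r lam g lam_ge0.
have h : lam * enorm g <= 2 * t / (3 * q).
  by apply: le_trans lamM; rewrite ler_wpM2l.
have := haar_laplace r_gt0 hrd (haar_matrix_invariant haar)
  (haar_matrix_stiefel r_gt0 haar) lam_ge0 h.
move=> /(lee_wpmul2l _) h2; apply: le_trans (h2 _ _) _.
  by rewrite lee_fin expR_ge0.
by rewrite -EFinM -expRD subrr expR0.
Qed.

(** Pairing the running product with the iterate gives a single recursion driven by the P_k, so that
    the pair, and not only the iterate, is independent of the next matrix. *)
Let step (z : (R * borelMx R d 1) * borelMx R d r) : R * borelMx R d 1 :=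
  (z.1.1 * laplace_factor z.2 (grad F z.1.2),
   z.1.2 - s *: ngd_direction z.2 (grad F z.1.2)).

Lemma measurable_grad_comp {dT} {S : measurableType dT} (y : S -> borelMx R d 1) :
  measurable_fun setT y ->
  forall i j, measurable_fun setT (fun z => grad F (y z) i j).
Proof.
move=> my i j; rewrite (ord1 j).
apply: (measurableT_comp (f := fun v : borelMx R d 1 => grad F v i 0)) => //.
by apply: measurable_continuous_borelMx; exact: continuous_grad hsmooth.
Qed.

Lemma measurable_ngd_step : measurable_fun setT step.
Proof.
have m1 : measurable_fun setT
    (fun z : (R * borelMx R d 1) * borelMx R d r => z.1.1).
  exact: (measurableT_comp measurable_fst measurable_fst).
have m2 : measurable_fun setT
    (fun z : (R * borelMx R d 1) * borelMx R d r => z.1.2).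
  exact: (measurableT_comp measurable_snd measurable_fst).
have m3 i j : measurable_fun setT
    (fun z : (R * borelMx R d 1) * borelMx R d r => (z.2 : 'M[R]_(d, r)) i j).
  by apply: measurable_mx_coord; exact: measurable_snd.
have mg := measurable_grad_comp m2.
apply: measurable_fun_pair.
  by apply: measurable_funM => //; exact: measurable_laplace_factor.
apply: measurable_fun_borelMx => i j.
rewrite (_ : (fun z => _) = (fun z : (R * borelMx R d 1) * borelMx R d r =>
  (z.1.2 : 'cV[R]_d) i j - s * ngd_direction z.2 (grad F z.1.2) i j)); last first.
  by apply/funext => z; rewrite !mxE.
apply: measurable_funB; first exact: measurable_mx_coord.
by apply: measurable_funM => //; exact: measurable_ngd_direction.
Qed.

Let V (k : nat) (w : Omega) : R * borelMx R d 1 := (laplace_product k w, x k w).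

Let V_independent : (forall k, measurable_fun setT (V k)) /\
  (forall k A B, measurable A -> measurable B ->
    Pr (V k @^-1` A `&` P k @^-1` B) = (Pr (V k @^-1` A) * Pr (P k @^-1` B))%E).
Proof.
apply: (independent_recursion (phi := step) (v0 := (1, x0))).
- exact: hP.1.
- exact: measurable_ngd_step.
- by move=> w; rewrite /V /laplace_product big_geq.
- by move=> k w; rewrite /V /laplace_product big_nat_recr.
Qed.

Lemma measurable_laplace_product k : measurable_fun setT (laplace_product k).
Proof. exact: (measurableT_comp measurable_fst (V_independent.1 k)). Qed.

Lemma measurable_rs_ngd k : measurable_fun setT (x k : Omega -> borelMx R d 1).
Proof. exact: (measurableT_comp measurable_snd (V_independent.1 k)). Qed.

Lemma integral_laplace_product k :
  (\int[Pr]_w (laplace_product k w)%:E <= 1)%E.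
Proof.
elim: k => [|k ih].
  under eq_integral do rewrite /laplace_product big_geq//.
  by rewrite integral_cst//= probability_setT mul1e.
apply: le_trans ih.
pose Vk : {RV Pr >-> (R * borelMx R d 1)%type} := mfun_Sub (mem_set (V_independent.1 k)).
(* The absolute value makes f nonnegative at every state, as Tonelli's theorem demands; on actual
   products, which are nonnegative, it changes nothing. *)
pose f (z : (R * borelMx R d 1) * borelMx R d r) : \bar R :=
  (`|z.1.1| * laplace_factor z.2 (grad F z.1.2))%:E.
have m1 : measurable_fun setT
    (fun z : (R * borelMx R d 1) * borelMx R d r => z.1.1).
  exact: (measurableT_comp measurable_fst measurable_fst).
have m2 : measurable_fun setT
    (fun z : (R * borelMx R d 1) * borelMx R d r => z.1.2).
  exact: (measurableT_comp measurable_snd measurable_fst).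
have m3 i j : measurable_fun setT
    (fun z : (R * borelMx R d 1) * borelMx R d r => (z.2 : 'M[R]_(d, r)) i j).
  by apply: measurable_mx_coord; exact: measurable_snd.
have := @independent_integral_le _ _ _ Pr _ _ _ _ Vk (P k) f
  (fun v => (`|v.1|)%:E) (V_independent.2 k).
have -> : (\int[Pr]_w f (Vk w, P k w) = \int[Pr]_w (laplace_product k.+1 w)%:E)%E.
  apply: eq_integral => w _; rewrite /f /= ger0_norm ?laplace_product_ge0//.
  by rewrite /laplace_product big_nat_recr.
have -> : (\int[Pr]_w (`|(Vk w).1|)%:E = \int[Pr]_w (laplace_product k w)%:E)%E.
  by apply: eq_integral => w _; rewrite /= ger0_norm ?laplace_product_ge0.
apply.
- apply/measurable_EFinP; apply: measurable_funM; first exact: measurableT_comp.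
  by apply: measurable_laplace_factor => //; exact: measurable_grad_comp.
- by move=> z; rewrite lee_fin mulr_ge0// laplace_factor_ge0.
- by apply/measurable_EFinP; apply: measurableT_comp => //; exact: measurable_fst.
- by move=> v; rewrite lee_fin.
move=> v; rewrite /f /=.
under eq_integral do rewrite EFinM.
rewrite ge0_integralZl_EFin//=.
- rewrite -[leRHS]mule1; apply: lee_wpmul2l; first by rewrite lee_fin.
  exact: integral_laplace_factor.
- by move=> p _; rewrite lee_fin laplace_factor_ge0.
- apply/measurable_EFinP; apply: measurable_laplace_factor => i j.
    exact: measurable_borelMx_coord.
  exact: measurable_cst.
Qed.

End ExponentialSupermartingale.

(** * Choice of the parameters and the pathwise conclusion *)

Theorem theoremD2 (R : realType) (d r : nat) (hr : (1 <= r)%N) (hrd : (r <= d)%N)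
  (F : 'cV[R]_d -> R) (L : R)
  (hdiff : forall x, differentiable F x)
  (hbound : has_lbound (range F))
  (hL : 0 < L) (hsmooth : smooth L F)
  (T : nat) (hT : (1 <= T)%N)
  (eta u : R) (heta : 0 < eta) (hu : 0 < u < 1)
  (disp : measure_display) (Omega : measurableType disp)
  (Pr : probability Omega R)
  (P : nat -> {RV Pr >-> borelMx R d r}) (hP : iid_haar_matrices hrd P)
  (x0 : 'cV[R]_d)
  (delta : R) (hdelta : 0 < delta < 1) :
  let etabar := eta * T%:R `^ (- u) in
  let x (k : nat) (w : Omega) := rs_ngd F etabar x0 (fun j => P j w) k in
  let Delta0 := F x0 - inf (range F) in
  let t : R := tau d r in
  let q : R := d%:R / r%:R in
  let bound : R :=
    (2 * Delta0) / (eta * t * T%:R `^ (1 - u))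
    + eta / (t * T%:R `^ u) * q * L
    + 3 / t ^+ 2
      * (q * (Num.sqrt (2 * Delta0 * L) / T%:R)
         + eta / T%:R `^ u * q `^ (3 / 2) * L)
      * ln (1 / delta) in
  ((1 - delta)%:E <=
   Pr [set w : Omega |
       (T%:R^-1 * \sum_(0 <= k < T) enorm (grad F (x k w)) <= bound)%R])%E.
Proof.
cbv zeta; case/andP: hdelta => de0 de1.
pose s := eta * T%:R `^ (- u).
pose x (k : nat) (w : Omega) := rs_ngd F s x0 (fun j => P j w) k.
pose D0 := F x0 - inf (range F); pose t : R := tau d r; pose q : R := d%:R / r%:R.
pose l := ln (1 / delta).
pose bound : R := 2 * D0 / (eta * t * T%:R `^ (1 - u))
  + eta / (t * T%:R `^ u) * q * L
  + 3 / t ^+ 2 * (q * (Num.sqrt (2 * D0 * L) / T%:R)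
    + eta / T%:R `^ u * q `^ (3 / 2) * L) * l.
rewrite -[X in (_ <= X)%E]/(Pr [set w | (T%:R^-1 * \sum_(0 <= k < T)
  enorm (grad F (x k w)) <= bound)%R]).
have Tp : (0 : R) < T%:R by rewrite ltr0n.
have vp : 0 < T%:R `^ (- u) by exact: powR_gt0.
have sp : 0 < s by rewrite mulr_gt0.
have dp : (0 : R) < d%:R by rewrite ltr0n (leq_trans hr).
have qp : 0 < q by rewrite divr_gt0// ltr0n.
have tp : 0 < t by rewrite tau_gt0// (leq_trans hr).
have sq0 : 0 < Num.sqrt q by rewrite sqrtr_gt0.
pose M := Num.sqrt (2 * D0 * L) + T%:R * (L * s * Num.sqrt q).
have Mp : 0 < M by rewrite ltr_wpDl ?sqrtr_ge0// !mulr_gt0.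
pose lam := 2 * t / (3 * q * M).
have lp : 0 < lam.
  by apply: divr_gt0; rewrite ?(mulr_gt0 _ tp) ?(mulr_gt0 _ Mp) ?(mulr_gt0 _ qp).
have lamM : lam * M <= 2 * t / (3 * q).
  by rewrite le_eqVlt; apply/orP; left; apply/eqP; rewrite /lam; field; rewrite !gt_eqF.
have lge := ltW lp.
pose W := laplace_product F P s x0 lam M.
have mx k : measurable_fun setT (x k : Omega -> borelMx R d 1).
  exact: (measurable_rs_ngd hL hsmooth hP s x0 lam M k).
have mW : measurable_fun setT (W T).
  exact: (measurable_laplace_product hL hsmooth hP s x0 lam M T).
have W0 w : 0 <= W T w by exact: laplace_product_ge0.
have intW := integral_laplace_product hr hL hsmooth hP s x0 lge lamM T.
have mD := @measurable_stiefel R d r.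
(* Two exceptional sets are discarded: the Markov event, of probability at most delta, and the null
   set where some P_k lies outside the scaled Stiefel set. What remains is a deterministic argument
   along one trajectory. *)
apply: (@probability_ge_of_subset _ _ _ Pr _ [set w | delta^-1 <= W T w]
  (fun k => P k @^-1` (@scaled_stiefel R d r))).
- have mS : measurable_fun setT
      (fun w => T%:R^-1 * \sum_(0 <= k < T) enorm (grad F (x k w))).
    apply: measurable_funM => //; apply: measurable_sum => k.
    by apply: measurable_enorm => i; exact: (measurable_grad_comp hL hsmooth (mx k)).
  have := mS measurableT _ (measurable_itv `]-oo, bound]); rewrite setTI.
  by congr measurable; apply/seteqP; split=> w /=; rewrite in_itv.
- have := mW measurableT _ (measurable_itv `[delta^-1, +oo[); rewrite setTI.
  by congr measurable; apply/seteqP; split=> w /=; rewrite in_itv /= andbT.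
- by move=> k; rewrite -[X in measurable X]setTI; exact: measurable_funPT.
- by move=> k; exact: (haar_matrix_stiefel hr (hP.2 k)).
- exact: markov_complement.
move=> w [/= /negP]; rewrite -ltNge => Wlt PD.
have {}PD j : scaled_stiefel (P j w) by exact: (PD j I).
have gM k : (k < T)%N -> enorm (grad F (x k w)) <= M.
  move=> kT; have := enorm_grad_rs_ngd hdiff hL hsmooth hbound (ltW sp) x0
    (k := k) (fun j _ => PD j).
  move=> /le_trans; apply.
  rewrite lerD2l ler_wpM2r ?ler_nat ?(ltnW kT)//.
  by rewrite !mulr_ge0// ltW.
pose S1 := \sum_(0 <= k < T) enorm (grad F (x k w)).
pose S2 := \sum_(0 <= k < T) enorm ((P k w : 'M[R]_(d, r))^T *m grad F (x k w)).
(* By [gM] the truncation is inactive along this trajectory, so every factor is a genuine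
   exponential. *)
have WE : W T w = expR (lam * (t / 2 * S1 - S2)).
  rewrite /W /laplace_product /S1 /S2 mulr_sumr -sumrB mulr_sumr expR_sum.
  rewrite big_nat_cond [RHS]big_nat_cond; apply: eq_bigr => k /andP[/andP[_ kT] _].
  by rewrite /laplace_factor gM.
(* The logarithm of W < 1 / delta. *)
have hS : t / 2 * S1 <= S2 + l / lam.
  rewrite /l div1r -lerBlDl ler_pdivlMr// mulrC -ler_expR -WE lnK ?posrE ?invr_gt0//.
  exact: ltW.
have hd := rs_ngd_descent hdiff hL hsmooth (ltW sp) x0 (fun j (_ : (j < T)%N) => PD j).
have hF : F x0 - F (x T w) <= D0 by rewrite lerD2l lerN2 inf_range_le.
have hS2 : S2 <= (D0 + T%:R * (L / 2 * s ^+ 2 * q)) / s.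
  by rewrite ler_pdivlMr// mulrC; apply: le_trans hd _; rewrite lerD2r.
rewrite -/S1.
(* The bound is exactly what [hS] and [hS2] give after division by T t / 2: the initial gap and the
   accumulated L s^2 q / 2 yield the first two summands, and l / lam with the two parts of M yields
   the last. *)
have -> : bound = T%:R^-1 * (2 / t * ((D0 + T%:R * (L / 2 * s ^+ 2 * q)) / s + l / lam)).
  have vE : T%:R `^ (1 - u) = T%:R * T%:R `^ (- u) :> R.
    by rewrite powRD ?powRr1// (gt_eqF Tp) implybT.
  have uE : T%:R `^ u = (T%:R `^ (- u))^-1 :> R by rewrite powRN invrK.
  have qE : q `^ (3 / 2) = q * Num.sqrt q.
    have -> : 3 / 2 = 1 + 2^-1 :> R by field.
    by rewrite powRD ?(gt_eqF qp) ?implybT// powRr1 ?powR12_sqrt// ltW.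
  rewrite /bound vE uE qE /lam /M /s.
  have := Mp; rewrite /M /s.
  move: (Num.sqrt (2 * D0 * L)) (Num.sqrt q) sq0 (T%:R `^ (- u)) vp => a b b0 v v0 M0.
  field; rewrite (gt_eqF M0) (gt_eqF qp) (gt_eqF tp) (gt_eqF v0).
  by rewrite (gt_eqF heta) (gt_eqF Tp).
rewrite ler_pM2l ?invr_gt0// -ler_pdivrMl ?divr_gt0// invf_div mulrC.
by rewrite mulrC; apply: le_trans hS _; rewrite lerD2r.
Qed.
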